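(* Let $B=\Bbbk\langle a,b,c\mid a^2,\,b^2,\,c^2,\,ab+bc+ca,\,ba+cb+ac\rangle$ be the 12-dimensional Fomin-Kirillov algebra and $E_n(B)=\operatorname{Ext}^n_B(\Bbbk,\Bbbk)$. Define integers $N_n$ ($n\ge 0$) by $N_0=1$, $N_1=3$, $N_2=5$, $N_3=6$ and $N_{n+4}=N_n+6$ for all $n\ge 0$. Then $\dim_\Bbbk E_n(B)=N_n$ for all $n\in\mathbb N$.
   Context: $\Bbbk$ is a field of characteristic zero, and $\Bbbk$ as a $B$-module is the trivial module on which $a,b,c$ act by $0$. *)

(* Defs.v *)
From HB Require Import structures.
From mathcomp Require Import all_boot all_order all_algebra.
From mathcomp.classical Require Import boolp.
From mathcomp.multinomials Require Import monalg.

Set Implicit Arguments.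
Unset Strict Implicit.
Unset Printing Implicit Defensive.

Import GRing.Theory.

Local Open Scope ring_scope.
Local Open Scope quotient_scope.

Definition projective (R : pzRingType) (P : lmodType R) : Prop :=
  forall (M N : lmodType R) (g : {linear M -> N}) (f : {linear P -> N}),
    (forall y, exists x, g x = y) ->
    exists h : {linear P -> M}, forall x, g (h x) = f x.

(* ... -> res_mod 2 -> res_mod 1 -> res_mod 0 -> M -> 0, with                 *)
(* res_diff n : res_mod n.+1 -> res_mod n.                                    *)
Record proj_resolution (R : pzRingType) (M : lmodType R) := ProjResolution {
  res_mod : nat -> lmodType R;
  res_diff : forall n, {linear res_mod n.+1 -> res_mod n};
  res_aug : {linear res_mod 0 -> M};
  res_proj : forall n, projective (res_mod n);
  res_aug_surj : forall y, exists x, res_aug x = y;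
  res_exact0 : forall x, res_aug x = 0 <-> exists y, x = res_diff 0 y;
  res_exact : forall n (x : res_mod n.+1),
    res_diff n x = 0 <-> exists y, x = res_diff n.+1 y
}.

Section Ext.
Variables (k : fieldType) (A : algType k) (M N : lmodType A).

Section Cohomology.
Variable P : proj_resolution M.

Definition cocycle n (f : res_mod P n -> N) : Prop :=
  forall x, f (res_diff P n x) = 0.

Definition coboundary n : (res_mod P n -> N) -> Prop :=
  match n with
  | 0 => fun f => forall x, f x = 0
  | m.+1 => fun f => exists g : {linear res_mod P m -> N},
                       forall x, f x = g (res_diff P m x)
  end.

(* The classes of the z i form a k-basis of H^n(Hom_A(P, N)), where k acts on *)
(* Hom_A(P n, N) by (l f)(x) = l%:A *: f x.                                   *)
Definition cohomology_basis n d
    (z : 'I_d -> {linear res_mod P n -> N}) : Prop :=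
  (forall i, cocycle (z i)) /\
  (forall f : {linear res_mod P n -> N}, cocycle f ->
     exists! l : {ffun 'I_d -> k},
       coboundary (fun x => f x - \sum_(i < d) (l i)%:A *: z i x)).

End Cohomology.

(* dim_k Ext^n_A(M, N) = d.  Ext is the cohomology of Hom_A(P, N) for a       *)
(* projective resolution P of M; no resolution is singled out, and one is     *)
(* required to exist so that the quantification over P is not vacuous.        *)
Definition Ext_dim n d : Prop :=
  inhabited (proj_resolution M) /\
  forall P : proj_resolution M,
    exists z : 'I_d -> {linear res_mod P n -> N}, cohomology_basis z.

End Ext.

(* Locked because unification would otherwise unfold malg when comparing      *)
(* distinct generators.                                                       *)
HB.lock Definition FKgen (k : fieldType) (i : 'I_3) : {malg k[{fmonom 'I_3}]} :=
  mkmalgU (fmu i) 1.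
Canonical FKgen_unlockable := Unlockable FKgen.unlock.

Section FominKirillov.
Variable k : fieldType.

(* k<a, b, c>: the monoid algebra over k of the free monoid on 'I_3. *)
Local Notation free3 := {malg k[{fmonom 'I_3}]}.

Local Notation Xa := (FKgen k (@Ordinal 3 0 isT)).
Local Notation Xb := (FKgen k (@Ordinal 3 1 isT)).
Local Notation Xc := (FKgen k (@Ordinal 3 2 isT)).

Definition FK_rels : seq free3 :=
  [:: Xa ^+ 2; Xb ^+ 2; Xc ^+ 2;
      Xa * Xb + Xb * Xc + Xc * Xa;
      Xb * Xa + Xc * Xb + Xa * Xc].

Definition in_FK_ideal (x : free3) : Prop :=
  exists2 s : seq (free3 * free3 * free3),
    {in s, forall t, t.1.2 \in FK_rels}
    & x = \sum_(t <- s) t.1.1 * t.1.2 * t.2.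

Definition FK_ideal (x : free3) : bool := `[< in_FK_ideal x >].

Lemma FK_idealP x : reflect (in_FK_ideal x) (x \in FK_ideal).
Proof. exact: asboolP. Qed.

Lemma FK_ideal_zmod_closed : zmod_closed FK_ideal.
Proof.
split=> [|x y /FK_idealP[s sP ->] /FK_idealP[t tP ->]]; apply/FK_idealP.
  by exists [::]; rewrite ?big_nil.
exists (s ++ [seq (- u.1.1, u.1.2, u.2) | u <- t]).
  by move=> u; rewrite mem_cat => /orP[/sP//|/mapP[v /tP vP ->]].
rewrite big_cat big_map /= -sumrN; congr (_ + _).
by apply: eq_bigr => u _; rewrite !mulNr.
Qed.

HB.instance Definition _ :=
  GRing.isZmodClosed.Build free3 FK_ideal FK_ideal_zmod_closed.

Lemma FK_idealMl u x : x \in FK_ideal -> u * x \in FK_ideal.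
Proof.
move=> /FK_idealP[s sP ->]; apply/FK_idealP.
exists [seq (u * t.1.1, t.1.2, t.2) | t <- s].
  by move=> t /mapP[v /sP vP ->].
by rewrite big_map mulr_sumr; apply: eq_bigr => t _; rewrite !mulrA.
Qed.

Lemma FK_idealMr u x : x \in FK_ideal -> x * u \in FK_ideal.
Proof.
move=> /FK_idealP[s sP ->]; apply/FK_idealP.
exists [seq (t.1.1, t.1.2, t.2 * u) | t <- s].
  by move=> t /mapP[v /sP vP ->].
by rewrite big_map mulr_suml; apply: eq_bigr => t _; rewrite !mulrA.
Qed.

Lemma FK_idealD x y :
  x \in FK_ideal -> y \in FK_ideal -> x + y \in FK_ideal.
Proof. exact: (GRing.zmod_closedD FK_ideal_zmod_closed).2. Qed.

Lemma FK_ideal_rel r : r \in FK_rels -> r \in FK_ideal.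
Proof.
move=> rP; apply/FK_idealP; exists [:: (1, r, 1)].
  by move=> t; rewrite inE => /eqP ->.
by rewrite big_seq1 mul1r mulr1.
Qed.

(* The coefficient of the empty word, i.e. the algebra morphism to k killing  *)
(* the three generators.                                                      *)
Definition aug3 (x : free3) : k := mcoeff mone x.

Lemma aug3B x y : aug3 (x - y) = aug3 x - aug3 y. Proof. exact: raddfB. Qed.
Lemma aug3D x y : aug3 (x + y) = aug3 x + aug3 y. Proof. exact: raddfD. Qed.
Lemma aug3_sum I (r : seq I) (F : I -> free3) :
  aug3 (\sum_(i <- r) F i) = \sum_(i <- r) aug3 (F i).
Proof. exact: raddf_sum. Qed.
Lemma aug3M x y : aug3 (x * y) = aug3 x * aug3 y.
Proof. exact: (mcoeff1g_is_multiplicative _ _).1. Qed.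
Lemma aug3_1 : aug3 1 = 1.
Proof. exact: (mcoeff1g_is_multiplicative _ _).2. Qed.
Lemma aug3Z l x : aug3 (l *: x) = l * aug3 x.
Proof. exact: mcoeffZ. Qed.
Lemma aug3_gen i : aug3 (FKgen k i) = 0.
Proof. by rewrite /aug3 unlock mcoeffU fm1_eq1. Qed.

Lemma aug3_genM i j : aug3 (FKgen k i * FKgen k j) = 0.
Proof. by rewrite aug3M aug3_gen mul0r. Qed.
Lemma aug3D0 x y : aug3 x = 0 -> aug3 y = 0 -> aug3 (x + y) = 0.
Proof. by move=> x0 y0; rewrite aug3D x0 y0 addr0. Qed.

Lemma aug3_ideal x : x \in FK_ideal -> aug3 x = 0.
Proof.
move=> /FK_idealP[s sP ->]; rewrite aug3_sum big_seq big1 // => t /sP tP.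
rewrite !aug3M.
suff -> : aug3 t.1.2 = 0 by rewrite mulr0 mul0r.
move: tP; rewrite /FK_rels !in_cons in_nil.
case/orP=> [/eqP->|/orP[/eqP->|/orP[/eqP->|/orP[/eqP->|/orP[/eqP->|//]]]]].
- exact: aug3_genM.
- exact: aug3_genM.
- exact: aug3_genM.
- by apply: aug3D0 (aug3_genM _ _); apply: aug3D0; apply: aug3_genM.
- by apply: aug3D0 (aug3_genM _ _); apply: aug3D0; apply: aug3_genM.
Qed.

Lemma scale3Ar (l : k) (x y : free3) : l *: (x * y) = x * (l *: y).
Proof.
suff cE (z : free3) : z * malgC l = l *: z.
  by rewrite -!cE -mulrA !cE -mul_malgC mulrA cE.
rewrite malgM_def malgZ_def fgmulgU; apply: eq_bigr => u _.
by rewrite mulm1 mulrC.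
Qed.

Definition FK := Quotient.quot (GRing.ZmodClosed.clone free3 FK_ideal _).
HB.instance Definition _ := GRing.Zmodule.on FK.
HB.instance Definition _ := EqQuotient.on FK.

Definition FK_pi (x : free3) : FK := \pi_FK x.

Lemma FK_piP x y : reflect (FK_pi x = FK_pi y) (x - y \in FK_ideal).
Proof. by rewrite Quotient.idealrBE; apply: eqP. Qed.

Lemma FK_repr_pi x : repr (FK_pi x) - x \in FK_ideal.
Proof. by apply/FK_piP; apply: reprK. Qed.

Lemma FK_reprK (u : FK) : FK_pi (repr u) = u.
Proof. exact: reprK. Qed.

Lemma FK_piD x y : FK_pi (x + y) = FK_pi x + FK_pi y.
Proof. exact: Quotient.pi_add. Qed.

Lemma FK_pi0 : FK_pi 0 = 0.
Proof. by apply: (addrI (FK_pi 0)); rewrite -FK_piD !addr0. Qed.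

Definition FK_one : FK := FK_pi 1.

End FominKirillov.

HB.lock Definition FK_mul (k : fieldType) (u v : FK k) : FK k :=
  FK_pi (repr u * repr v).
Canonical FK_mul_unlockable := Unlockable FK_mul.unlock.
HB.lock Definition FK_scale (k : fieldType) (l : k) (u : FK k) : FK k :=
  FK_pi (l *: repr u).
Canonical FK_scale_unlockable := Unlockable FK_scale.unlock.

Section FKAlgebra.
Variable k : fieldType.
Local Notation free3 := {malg k[{fmonom 'I_3}]}.
Local Notation Xa := (FKgen k (@Ordinal 3 0 isT)).
Local Notation Xb := (FKgen k (@Ordinal 3 1 isT)).
Local Notation Xc := (FKgen k (@Ordinal 3 2 isT)).
Local Notation FK := (FK k).
Local Notation FK_one := (FK_one k).
Local Notation FK_mul := (@FK_mul k).
Local Notation FK_scale := (@FK_scale k).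

Lemma FK_mul_pi x y : FK_mul (FK_pi x) (FK_pi y) = FK_pi (x * y).
Proof.
rewrite FK_mul.unlock; apply/FK_piP; set x' := repr _; set y' := repr _.
have -> : x' * y' - x * y = (x' - x) * y' + x * (y' - y).
  by rewrite mulrBl mulrBr addrA subrK.
by apply: FK_idealD; [apply/FK_idealMr|apply/FK_idealMl]; apply/FK_repr_pi.
Qed.

Lemma FK_scale_pi l x : FK_scale l (FK_pi x) = FK_pi (l *: x).
Proof.
rewrite FK_scale.unlock; apply/FK_piP; rewrite -scalerBr -mul_malgC.
exact/FK_idealMl/FK_repr_pi.
Qed.

Fact FK_mulA : associative FK_mul.
Proof.
move=> u v w; rewrite -[u]FK_reprK -[v]FK_reprK -[w]FK_reprK.
by rewrite !FK_mul_pi mulrA.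
Qed.
Fact FK_mul1 : left_id FK_one FK_mul.
Proof. by move=> u; rewrite -[u]FK_reprK FK_mul_pi mul1r. Qed.
Fact FK_mulr1 : right_id FK_one FK_mul.
Proof. by move=> u; rewrite -[u]FK_reprK FK_mul_pi mulr1. Qed.
Fact FK_mulDl : left_distributive FK_mul +%R.
Proof.
move=> u v w; rewrite -[u]FK_reprK -[v]FK_reprK -[w]FK_reprK.
by rewrite -FK_piD !FK_mul_pi -FK_piD mulrDl.
Qed.
Fact FK_mulDr : right_distributive FK_mul +%R.
Proof.
move=> u v w; rewrite -[u]FK_reprK -[v]FK_reprK -[w]FK_reprK.
by rewrite -FK_piD !FK_mul_pi -FK_piD mulrDr.
Qed.
Fact FK_one_neq0 : FK_one != 0.
Proof.
apply/eqP; rewrite -FK_pi0 => /FK_piP.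
by rewrite subr0 => /aug3_ideal/eqP; rewrite aug3_1 oner_eq0.
Qed.

HB.instance Definition _ := GRing.Zmodule_isNzRing.Build FK
  FK_mulA FK_mul1 FK_mulr1 FK_mulDl FK_mulDr FK_one_neq0.

Fact FK_scaleA l m u : FK_scale l (FK_scale m u) = FK_scale (l * m) u.
Proof. by rewrite -[u]FK_reprK !FK_scale_pi scalerA. Qed.
Fact FK_scale1 : left_id 1 FK_scale.
Proof. by move=> u; rewrite -[u]FK_reprK FK_scale_pi scale1r. Qed.
Fact FK_scaleDr : right_distributive FK_scale +%R.
Proof.
move=> l u v; rewrite -[u]FK_reprK -[v]FK_reprK.
by rewrite -FK_piD !FK_scale_pi -FK_piD scalerDr.
Qed.
Fact FK_scaleDl u : {morph FK_scale^~ u : l m / l + m}.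
Proof. by move=> l m; rewrite -[u]FK_reprK !FK_scale_pi -FK_piD scalerDl. Qed.

HB.instance Definition _ := GRing.Zmodule_isLmodule.Build k FK
  FK_scaleA FK_scale1 FK_scaleDr FK_scaleDl.

Lemma FK_pi1 : FK_pi 1 = 1. Proof. by []. Qed.
Lemma FK_piM x y : FK_pi (x * y) = FK_pi x * FK_pi y.
Proof. by rewrite -FK_mul_pi. Qed.
Lemma FK_piZ l x : FK_pi (l *: x) = l *: FK_pi x.
Proof. by rewrite -FK_scale_pi. Qed.

Fact FK_scaleAl (l : k) (u v : FK) : l *: (u * v) = (l *: u) * v.
Proof.
rewrite -[u]FK_reprK -[v]FK_reprK.
by rewrite -FK_piM -!FK_piZ -FK_piM scalerAl.
Qed.
HB.instance Definition _ := GRing.Lmodule_isLalgebra.Build k FK FK_scaleAl.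

Fact FK_scaleAr (l : k) (u v : FK) : l *: (u * v) = u * (l *: v).
Proof.
rewrite -[u]FK_reprK -[v]FK_reprK.
by rewrite -FK_piM -!FK_piZ -FK_piM scale3Ar.
Qed.
HB.instance Definition _ := GRing.Lalgebra_isAlgebra.Build k FK FK_scaleAr.

Lemma FK_pi_rel r : r \in FK_rels k -> FK_pi r = 0.
Proof.
by move=> /FK_ideal_rel rI; rewrite -FK_pi0; apply/FK_piP; rewrite subr0.
Qed.

Definition FKa : FK := FK_pi Xa.
Definition FKb : FK := FK_pi Xb.
Definition FKc : FK := FK_pi Xc.

Definition FK_aug (u : FK) : k := aug3 (repr u).

Lemma FK_augE x : FK_aug (FK_pi x) = aug3 x.
Proof. by apply/eqP; rewrite -subr_eq0 -aug3B aug3_ideal ?FK_repr_pi. Qed.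

(* A copy of k, on which FK acts through FK_aug.                              *)
Definition triv : Type := k.
HB.instance Definition _ := GRing.Zmodule.on triv.

Definition triv_scale (u : FK) (x : triv) : triv := FK_aug u * (x : k).

Fact triv_scaleA u v x :
  triv_scale u (triv_scale v x) = triv_scale (u * v) x.
Proof.
rewrite -[u]FK_reprK -[v]FK_reprK -FK_piM.
by rewrite /triv_scale !FK_augE aug3M mulrA.
Qed.
Fact triv_scale1 : left_id 1 triv_scale.
Proof. by move=> x; rewrite /triv_scale FK_augE aug3_1 mul1r. Qed.
Fact triv_scaleDr : right_distributive triv_scale +%R.
Proof. by move=> u x y; rewrite /triv_scale mulrDr. Qed.
Fact triv_scaleDl x : {morph triv_scale^~ x : u v / u + v}.
Proof.
move=> u v; rewrite -[u]FK_reprK -[v]FK_reprK -FK_piD.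
by rewrite /triv_scale !FK_augE aug3D mulrDl.
Qed.

HB.instance Definition _ := GRing.Zmodule_isLmodule.Build FK triv
  triv_scaleA triv_scale1 triv_scaleDr triv_scaleDl.

Lemma triv_a (x : triv) : FKa *: x = 0.
Proof. by rewrite /GRing.scale /= /triv_scale FK_augE aug3_gen mul0r. Qed.
Lemma triv_b (x : triv) : FKb *: x = 0.
Proof. by rewrite /GRing.scale /= /triv_scale FK_augE aug3_gen mul0r. Qed.
Lemma triv_c (x : triv) : FKc *: x = 0.
Proof. by rewrite /GRing.scale /= /triv_scale FK_augE aug3_gen mul0r. Qed.
Lemma triv_scalar (l : k) (x : triv) : l%:A *: x = l * (x : k) :> k.
Proof.
rewrite {1}/GRing.scale /= /triv_scale; congr (_ * _).
by rewrite -FK_pi1 -FK_piZ FK_augE aug3Z aug3_1 mulr1.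
Qed.

End FKAlgebra.

Fixpoint FK_N (n : nat) : nat :=
  match n with
  | 0 => 1
  | 1 => 3
  | 2 => 5
  | 3 => 6
  | m.+4 => FK_N m + 6
  end%N.

(* Main.v *)
Require Import Defs.
From HB Require Import structures.
From mathcomp Require Import all_boot all_order all_algebra.
From mathcomp.classical Require Import boolp.
From mathcomp.multinomials Require Import monalg.

Set Implicit Arguments.
Unset Strict Implicit.
Unset Printing Implicit Defensive.

Import GRing.Theory.
Local Open Scope ring_scope.

(** The Koszul complex K of the quadratic algebra B consists of free modules of
    ranks 1, 3, 5, 6, 6, 6, ..., and its differential is constant from degree 4
    on: the sum of diag(a, b, c) and of the 3 x 3 matrix (x_{i+j}) with
    (x_0, x_1, x_2) = (a, b, c) and indices modulo 3. Its homology is k in degrees 0 and 3, and is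
    zero elsewhere. The class in degree 3 extends to an anticommuting map
    K_n -> K_{n+3}, and gluing the shifted copies of K along this map kills the
    extra homology and gives a free resolution P of k with P_{n+4} = P_n + K_{n+4}.
    All the entries of its differentials lie in the augmentation ideal, so that
    dim Ext^n(k, k) is the rank of P_n. The exactness of K is a finite
    verification, done with explicit k-linear contracting homotopies over the
    basis of words of B. *)

(** * Comparison of projective resolutions *)

Section Pullback.
Variables (R : pzRingType) (P Q N : lmodType R).
Variables (f : {linear P -> N}) (g : {linear Q -> N}).

Definition pullback_pred : {pred P * Q} := fun u => f u.1 == g u.2.

Lemma pullback_submod_closed : submod_closed pullback_pred.
Proof.
split=> [|a u v]; first by rewrite unfold_in /= !raddf0.
by rewrite !unfold_in /= !linearP => /eqP-> /eqP->.
Qed.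

Record pullback := Pullback { pullback_val : P * Q; _ : pullback_val \in pullback_pred }.

HB.instance Definition _ := [isSub for pullback_val].
HB.instance Definition _ := [Choice of pullback by <:].
HB.instance Definition _ := GRing.SubChoice_isSubLmodule.Build R (P * Q)%type
  pullback_pred pullback (GRing.submod_closed_semi pullback_submod_closed).

Definition pullback_fst (u : pullback) : P := (val u).1.
Definition pullback_snd (u : pullback) : Q := (val u).2.

Fact pullback_fst_linear : linear pullback_fst.
Proof. by move=> a u v; rewrite /pullback_fst linearP. Qed.
Fact pullback_snd_linear : linear pullback_snd.
Proof. by move=> a u v; rewrite /pullback_snd linearP. Qed.
HB.instance Definition _ := GRing.isLinear.Build R pullback P *:%R pullback_fst
  pullback_fst_linear.
HB.instance Definition _ := GRing.isLinear.Build R pullback Q *:%R pullback_snd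
  pullback_snd_linear.

(** [projective] lifts along surjections only, and [g] need not be onto. The condition on images
    makes the first projection of the pullback onto; a section of it, followed by the second
    projection, is the lift. *)
Lemma projective_lift : projective P -> (forall x, exists y, f x = g y) ->
  exists h : {linear P -> Q}, forall x, g (h x) = f x.
Proof.
move=> projP imf.
have [|h hK] := projP pullback P pullback_fst idfun.
  move=> x; have [y fgE] := imf x.
  have uP : (x, y) \in pullback_pred by rewrite unfold_in /= fgE.
  by exists (Pullback uP).
exists (pullback_snd \o h) => x /=.
have {2}<- : pullback_fst (h x) = x := hK x.
by have := valP (h x); rewrite unfold_in => /eqP.
Qed.

End Pullback.

(** The types vary with n, as do those of the components of a chain map. [I] is the invariant that
    makes the next choice possible, and [E] ties consecutive choices. *)
Lemma dependent_choice (T : nat -> Type) (I : forall n, T n -> Prop)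
    (E : forall n, T n -> T n.+1 -> Prop) :
  (exists x, I 0%N x) ->
  (forall n x, I n x -> exists y, I n.+1 y /\ E n x y) ->
  exists s : forall n, T n, (forall n, I n (s n)) /\ forall n, E n (s n) (s n.+1).
Proof.
move=> /cid[x0 Ix0] step.
pose next n (u : {x | I n x}) := cid (step n (sval u) (svalP u)).
pose fix s n : {x | I n x} :=
  if n is m.+1 then exist _ (sval (next m (s m))) (svalP (next m (s m))).1
  else exist _ x0 Ix0.
exists (fun n => sval (s n)); split=> n; first exact: svalP.
exact: (svalP (next n (s n))).2.
Qed.

Section Comparison.
Variables (R : pzRingType) (M : lmodType R).
Implicit Types P Q : proj_resolution M.

Lemma res_diff_comp P n x : res_diff P n (res_diff P n.+1 x) = 0.
Proof. by apply/res_exact; exists x. Qed.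

Lemma res_aug_diff P x : res_aug P (res_diff P 0 x) = 0.
Proof. by apply/res_exact0; exists x. Qed.

Definition chain_map P Q (phi : forall n, {linear res_mod P n -> res_mod Q n}) :=
  (forall x, res_aug Q (phi 0%N x) = res_aug P x) /\
  forall n x, res_diff Q n (phi n.+1 x) = phi n (res_diff P n x).

Lemma chain_map_exists P Q : exists phi, @chain_map P Q phi.
Proof.
(* Besides compatibility with the augmentations in degree 0, the invariant says that f d takes
   values in the image of d, as the next lift requires; exactness of Q propagates it. *)
pose I n (f : {linear res_mod P n -> res_mod Q n}) :=
  match n return {linear res_mod P n -> res_mod Q n} -> Prop with
  | 0 => fun f => forall x, res_aug Q (f x) = res_aug P x
  | _ => fun=> True
  end f /\ forall x, exists y, f (res_diff P n x) = res_diff Q n y.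
pose E n (f : {linear res_mod P n -> res_mod Q n})
  (f' : {linear res_mod P n.+1 -> res_mod Q n.+1}) :=
  forall x, res_diff Q n (f' x) = f (res_diff P n x).
have [||phi [Iphi Ephi]] := @dependent_choice _ I E.
- have [f fE] := @res_proj _ _ P 0 _ _ (res_aug Q) (res_aug P) (@res_aug_surj _ _ Q).
  exists f; split=> // x; apply/res_exact0.
  by rewrite fE res_aug_diff.
- move=> n f [_ imf].
  have [f' f'E] := @projective_lift _ _ _ _
    (f \o res_diff P n) (res_diff Q n) (@res_proj _ _ P n.+1) imf.
  exists f'; split=> //; split=> // x; apply/res_exact.
  by rewrite f'E /= res_diff_comp raddf0.
by exists phi; split=> //; apply: (Iphi 0%N).1.
Qed.

(** Both theta and the identity lift the identity of M. Once h is chosen in degree n, the map 1 -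
    theta - h d in degree n + 1 has values in the kernel of d, hence in its image, and projectivity
    lifts it. *)
Lemma chain_map_homotopy P (theta : forall n, {linear res_mod P n -> res_mod P n}) :
  chain_map theta ->
  exists h : forall n, {linear res_mod P n -> res_mod P n.+1},
    (forall x, res_diff P 0 (h 0%N x) = x - theta 0%N x) /\
    forall n x, res_diff P n.+1 (h n.+1 x) = x - theta n.+1 x - h n (res_diff P n x).
Proof.
move=> [theta0 thetaS].
pose I n (h : {linear res_mod P n -> res_mod P n.+1}) :=
  match n return {linear res_mod P n -> res_mod P n.+1} -> Prop with
  | 0 => fun h => forall x, res_diff P 0 (h x) = x - theta 0%N x
  | _ => fun=> True
  end h /\ forall x, exists y,
    x - theta n.+1 x - h (res_diff P n x) = res_diff P n.+1 y.
pose E n (h : {linear res_mod P n -> res_mod P n.+1})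
  (h' : {linear res_mod P n.+1 -> res_mod P n.+2}) :=
  forall x, res_diff P n.+1 (h' x) = x - theta n.+1 x - h (res_diff P n x).
have [||h [Ih Eh]] := @dependent_choice _ I E.
- have [|h hE] := @projective_lift _ _ _ _
    (idfun \- theta 0%N) (res_diff P 0) (@res_proj _ _ P 0).
    by move=> x; apply/res_exact0; rewrite raddfB /= theta0 subrr.
  exists h; split=> // x; apply/res_exact.
  by rewrite !raddfB /= hE /= thetaS opprB addrA subrK subrr.
- move=> n h [_ imh].
  have [h' h'E] := @projective_lift _ _ _ _
    (idfun \- theta n.+1 \- (h \o res_diff P n))
    (res_diff P n.+1) (@res_proj _ _ P n.+1) imh.
  exists h'; split=> //; split=> // x; apply/res_exact.
  by rewrite !raddfB /= h'E /= res_diff_comp raddf0 subr0 thetaS subrr.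
by exists h; split=> //; apply: (Ih 0%N).1.
Qed.

End Comparison.

(** * Ext from a minimal resolution *)

Section MinimalResolution.
Variables (k : fieldType) (A : algType k) (M N : lmodType A).

(** The first hypothesis is minimality of Q relative to N: the complex Hom(Q, N) has zero
    differential, so that its cohomology is Hom(Q_n, N), with basis [e]. Since [Ext_dim] ranges over
    all resolutions P, this basis is pulled back along a comparison map phi : P -> Q. *)
Lemma Ext_dim_minimal (Q : proj_resolution M) n d
    (e : 'I_d -> {linear res_mod Q n -> N}) :
  (forall m (f : {linear res_mod Q m -> N}) x, f (res_diff Q m x) = 0) ->
  (forall f : {linear res_mod Q n -> N}, exists l : {ffun 'I_d -> k},
     forall x, f x = \sum_(i < d) (l i)%:A *: e i x) ->
  (forall l : {ffun 'I_d -> k},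
     (forall x, \sum_(i < d) (l i)%:A *: e i x = 0) -> l = 0) ->
  Ext_dim M N n d.
Proof.
move=> minQ spane freee; split=> [|P]; first by exists.
have [phi phiP] := chain_map_exists P Q; have [psi psiP] := chain_map_exists Q P.
have [h [h0 hS]] : exists h : forall n, {linear res_mod P n -> res_mod P n.+1},
    (forall x, res_diff P 0 (h 0%N x) = x - psi 0%N (phi 0%N x)) /\
    forall n x, res_diff P n.+1 (h n.+1 x) =
      x - psi n.+1 (phi n.+1 x) - h n (res_diff P n x).
  apply: (@chain_map_homotopy _ _ P (fun n => psi n \o phi n)); split=> [x|m x] /=.
    by rewrite psiP.1 phiP.1.
  by rewrite psiP.2 phiP.2.
have [h' [h'0 h'S]] : exists h : forall n, {linear res_mod Q n -> res_mod Q n.+1},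
    (forall x, res_diff Q 0 (h 0%N x) = x - phi 0%N (psi 0%N x)) /\
    forall n x, res_diff Q n.+1 (h n.+1 x) =
      x - phi n.+1 (psi n.+1 x) - h n (res_diff Q n x).
  apply: (@chain_map_homotopy _ _ Q (fun n => phi n \o psi n)); split=> [x|m x] /=.
    by rewrite phiP.1 psiP.1.
  by rewrite phiP.2 psiP.2.
(* Linear maps into N kill both d h' and h' d, so they do not see the homotopy between phi psi and
   the identity. *)
have e_hom i x : e i (phi n (psi n x)) = e i x.
  apply/eqP; rewrite eq_sym -subr_eq0 -linearB; apply/eqP.
  case: n e {spane freee} i x => [|m] e i x; first by rewrite -h'0 minQ.
  move: (h'S m x) => /esym/eqP; rewrite subr_eq => /eqP->.
  by rewrite linearD minQ add0r -[LHS]/((e i \o h' m) (res_diff Q m x)) minQ.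
(* Composition with psi turns coboundaries on P into coboundaries on Q, and these vanish. *)
have cob_psi (f : res_mod P n -> N) y : coboundary f -> f (psi n y) = 0.
  case: n f y {e spane freee e_hom} => [|m] f y /=; first exact.
  by case=> g ->; rewrite psiP.2 -[g _]/((g \o psi m) (res_diff Q m y)) minQ.
exists (fun i => e i \o phi n); split=> [i x /=|f cocf].
  by rewrite -phiP.2 minQ.
have [l lE] := spane (f \o psi n).
exists l; split=> [|l' cobl'].
  (* The difference is f (1 - psi phi) = f d h + f h d. The first term vanishes for a cocycle, so
     that the difference is the coboundary of f h, or zero in degree 0. *)
  have fE x : f x - \sum_(i < d) (l i)%:A *: e i (phi n x) =
      f (x - psi n (phi n x)) by rewrite linearB -lE.
  case: n f cocf {lE spane freee e_hom cob_psi} e fE => [|m] f cocf e fE /=.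
    by move=> x; rewrite fE -h0 cocf.
  exists (f \o h m) => x; rewrite fE /=.
  by have := hS m x => /esym/eqP; rewrite subr_eq => /eqP->; rewrite linearD cocf add0r.
(* Evaluation on psi x kills the coboundary and, by [e_hom], turns e phi back into e, so the
   coordinates can be compared in Hom(Q_n, N). *)
apply/eqP; rewrite -subr_eq0; apply/eqP/freee => x.
have := cob_psi _ x cobl'; rewrite /= -[f _]/((f \o psi n) x) lE -sumrB => E.
rewrite -[RHS]E; apply: eq_bigr => i _.
by rewrite !ffunE !scalerBl e_hom.
Qed.

End MinimalResolution.

(** * The basis of words *)

Section SparseVectors.
Variable T : eqType.

(* Formal integer combinations of keys; repetitions are allowed.              *)
Definition svec := seq (T * int).

Fixpoint scoef (x : T) (r : svec) : int :=
  if r is t :: r' then (if t.1 == x then t.2 else 0) + scoef x r' else 0.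

Definition szero (r : svec) := all (fun t => scoef t.1 r == 0) r.

Definition lin (V : zmodType) (e : T -> V) (r : svec) : V :=
  \sum_(t <- r) e t.1 *~ t.2.

Lemma lin_nil (V : zmodType) (e : T -> V) : lin e [::] = 0.
Proof. exact: big_nil. Qed.

Lemma lin_cons (V : zmodType) (e : T -> V) t r :
  lin e (t :: r) = e t.1 *~ t.2 + lin e r.
Proof. exact: big_cons. Qed.

Lemma lin_cat (V : zmodType) (e : T -> V) r s :
  lin e (r ++ s) = lin e r + lin e s.
Proof. exact: big_cat. Qed.

Lemma lin1 (V : zmodType) (e : T -> V) x : lin e [:: (x, 1)] = e x.
Proof. by rewrite lin_cons lin_nil addr0. Qed.

Lemma eq_lin (V : zmodType) (e e' : T -> V) r : e =1 e' -> lin e r = lin e' r.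
Proof. by move=> ee'; apply: eq_bigr => t _; rewrite ee'. Qed.

Lemma scoefE x r : scoef x r = \sum_(t <- r | t.1 == x) t.2.
Proof.
elim: r => [|t r IHr]; first by rewrite big_nil.
by rewrite big_cons /= IHr; case: ifP; rewrite ?add0r.
Qed.

(** Terms are grouped by key, and each key then carries its total coefficient, which is 0. The test
    involves integers only, so one computation serves all fields k and all values [e]. *)
Lemma szeroP (V : zmodType) (e : T -> V) r : szero r -> lin e r = 0.
Proof.
move=> /allP r0; rewrite /lin.
under eq_big_seq => t tr.
  rewrite (_ : e t.1 *~ t.2 = \sum_(x <- undup (map fst r) | x == t.1) e x *~ t.2).
  over.
  rewrite big_mkcond (bigD1_seq t.1) ?mem_undup ?map_f ?undup_uniq //= eqxx.
  by rewrite big1 ?addr0 // => x /negbTE->.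
rewrite /= (exchange_big_dep predT) //= big_seq big1 // => x.
rewrite mem_undup => /mapP[t tr ->].
under eq_bigl do rewrite eq_sym.
by rewrite -mulrz_sumr -scoefE (eqP (r0 _ tr)) mulr0z.
Qed.

End SparseVectors.

Definition sbind (T U : eqType) (f : T -> svec U) (r : svec T) : svec U :=
  flatten [seq [seq (u.1, u.2 * t.2) | u <- f t.1] | t <- r].

Lemma lin_sbind (T U : eqType) (V : zmodType) (e : U -> V) (f : T -> svec U) r :
  lin e (sbind f r) = lin (fun x => lin e (f x)) r.
Proof.
rewrite /lin /sbind big_flatten big_map; apply: eq_bigr => t _.
by rewrite big_map mulrz_suml; apply: eq_bigr => u _; rewrite mulrzA.
Qed.

Lemma raddf_lin (T : eqType) (V W : zmodType) (f : {additive V -> W}) e (r : svec T) :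
  f (lin e r) = lin (f \o e) r.
Proof. by rewrite raddf_sum; apply: eq_bigr => t _; rewrite raddfMz. Qed.

(* The words 1, a, b, ab, ba, aba, c, ac, bc, abc, bac, abac.                 *)
Definition basis_letters : seq (seq nat) :=
  let s := [:: [::]; [:: 0]; [:: 1]; [:: 0; 1]; [:: 1; 0]; [:: 0; 1; 0]]%N in
  s ++ [seq rcons w 2%N | w <- s].

Local Notation P x := (x%N, Posz 1).
Local Notation M x := (x%N, Negz 0).

(* Right multiplication of the basis words by a, b, c, obtained from          *)
(* ca = - ab - bc, cb = - ba - ac and bab = aba.                              *)
Definition basis_mulr (g p : nat) : svec nat :=
  nth [::] (nth [::] [::
    [:: [:: P 1]; [::]; [:: P 4]; [:: P 5]; [::]; [::];
        [:: M 3; M 8]; [:: M 9]; [:: M 5]; [::]; [:: M 11]; [::]];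
    [:: [:: P 2]; [:: P 3]; [::]; [::]; [:: P 5]; [::];
        [:: M 4; M 7]; [:: M 5]; [:: M 10]; [:: M 11]; [::]; [::]];
    [:: [:: P 6]; [:: P 7]; [:: P 8]; [:: P 9]; [:: P 10]; [:: P 11];
        [::]; [::]; [::]; [::]; [::]; [::]]] g) p.

(* Empty when q is not below 12, in accordance with basis_word.               *)
Definition basis_mul (p q : nat) : svec nat :=
  if (q < 12)%N then
    foldl (fun r g => sbind (basis_mulr g) r) [:: P p] (nth [::] basis_letters q)
  else [::].

Section Basis.
Variable k : fieldType.
Local Notation B := (FK k).

Definition letter (g : nat) : B := nth 0 [:: FKa k; FKb k; FKc k] g.

Definition basis_word (p : nat) : B :=
  if (p < 12)%N then foldl (fun u g => u * letter g) 1 (nth [::] basis_letters p)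
  else 0.

Lemma FK_pi_nth_rel i : (i < 5)%N -> FK_pi (nth 0 (FK_rels k) i) = 0.
Proof. by move=> lti; apply/FK_pi_rel/mem_nth. Qed.

Lemma FKaa : FKa k * FKa k = 0.
Proof. by rewrite -FK_piM; apply: (@FK_pi_nth_rel 0). Qed.
Lemma FKbb : FKb k * FKb k = 0.
Proof. by rewrite -FK_piM; apply: (@FK_pi_nth_rel 1). Qed.
Lemma FKcc : FKc k * FKc k = 0.
Proof. by rewrite -FK_piM; apply: (@FK_pi_nth_rel 2). Qed.
Lemma FKca : FKc k * FKa k = - (FKa k * FKb k) - FKb k * FKc k.
Proof.
apply/eqP; rewrite -opprD -subr_eq0 opprK addrC -!FK_piM -!FK_piD; apply/eqP.
exact: (@FK_pi_nth_rel 3).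
Qed.
Lemma FKcb : FKc k * FKb k = - (FKb k * FKa k) - FKa k * FKc k.
Proof.
apply/eqP; rewrite -opprD -subr_eq0 opprK addrC addrAC -!FK_piM -!FK_piD; apply/eqP.
exact: (@FK_pi_nth_rel 4).
Qed.

(* Reduce (ca)a = 0 with the relations for ca.                                *)
Lemma FKbab : FKb k * FKa k * FKb k = FKa k * FKb k * FKa k.
Proof.
have: FKc k * FKa k * FKa k = 0 by rewrite -mulrA FKaa mulr0.
rewrite FKca mulrBl mulNr -[FKb k * FKc k * _]mulrA FKca mulrBr mulrN !mulrA FKbb mul0r subr0 opprK.
by rewrite addrC => /eqP; rewrite subr_eq0 => /eqP.
Qed.

Lemma basis_word_letter p g : basis_word p * letter g = lin basis_word (basis_mulr g p).
Proof.
(* The rewriting rules are stated after an arbitrary prefix u because words are left-nested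
   products. Indices beyond the three letters or the twelve words give zero on both sides. *)
have aa u : u * FKa k * FKa k = 0 by rewrite -mulrA FKaa mulr0.
have bb u : u * FKb k * FKb k = 0 by rewrite -mulrA FKbb mulr0.
have cc u : u * FKc k * FKc k = 0 by rewrite -mulrA FKcc mulr0.
have ca u : u * FKc k * FKa k = - (u * FKa k * FKb k) - u * FKb k * FKc k.
  by rewrite -mulrA FKca mulrBr mulrN !mulrA.
have cb u : u * FKc k * FKb k = - (u * FKb k * FKa k) - u * FKa k * FKc k.
  by rewrite -mulrA FKcb mulrBr mulrN !mulrA.
have bab u : u * FKb k * FKa k * FKb k = u * FKa k * FKb k * FKa k.
  by have := congr1 (fun v => u * v) FKbab; rewrite !mulrA.
pose rules := (aa, bb, cc, ca, cb, bab).
do 3?[case: g => [|g]]; last first.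
  by rewrite /letter /= nth_nil mulr0 /basis_mulr !nth_default // lin_nil.
all: do 12?[case: p => [|p]];
  try by [rewrite /basis_word /= mul0r /basis_mulr nth_default // lin_nil].
all: rewrite /basis_mulr /= ?lin_cons lin_nil /basis_word /letter /= ?addr0 ?mulrN1z ?mulr1z //.
all: by rewrite ?(rules, mul0r, mulNr, mulrBl, opprK, oppr0, add0r, addr0, sub0r, subr0).
Qed.

Lemma basis_word_mul p q : basis_word p * basis_word q = lin basis_word (basis_mul p q).
Proof.
rewrite {2}/basis_word /basis_mul; case: ifP => _; last by rewrite mulr0 lin_nil.
have -> (w : seq nat) : basis_word p * foldl (fun u g => u * letter g) 1 w =
    foldl (fun u g => u * letter g) (lin basis_word [:: P p]) w.
  rewrite lin1; elim/last_ind: w => [|w g IHw] /=; first by rewrite mulr1.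
  by rewrite !foldl_rcons mulrA IHw.
elim/last_ind: (nth _ _ q) => [|w g IHw] //=.
rewrite !foldl_rcons IHw lin_sbind /lin mulr_suml.
by apply: eq_bigr => t _; rewrite mulrzAl basis_word_letter.
Qed.

End Basis.

(** * The regular representation and coordinates on B *)

Section Coordinates.
Variable k : fieldType.
Local Notation B := (FK k).
Local Notation free3 := {malg k[{fmonom 'I_3}]}.

Definition unit_row (p : nat) : 'rV[k]_12 := \row_j ((j == p :> nat)%:R).

(* The right regular representation of FK, in the basis of words.             *)
Definition letter_mx (g : nat) : 'M[k]_12 := \matrix_(p < 12) lin unit_row (basis_mulr g p).

Lemma unit_row_letter p g : unit_row p *m letter_mx g = lin unit_row (basis_mulr g p).
Proof.
have [ltp|lep] := ltnP p 12.
  have -> : unit_row p = delta_mx 0 (Ordinal ltp).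
    by apply/rowP=> j; rewrite !mxE eqxx.
  by rewrite -rowE rowK.
have -> : unit_row p = 0.
  by apply/rowP=> j; rewrite !mxE; case: eqP => // jp; move: (ltn_ord j); rewrite jp ltnNge lep.
rewrite mul0mx /basis_mulr; case: g => [|[|[|g]]]; rewrite nth_default ?lin_nil //.
by rewrite [nth _ _ g.+3]nth_default.
Qed.

Lemma lin_unit_row_letter r g :
  lin unit_row r *m letter_mx g = lin unit_row (sbind (basis_mulr g) r).
Proof.
rewrite lin_sbind -[lin _ r *m _]/((mulmxr (letter_mx g)) _) raddf_lin.
by apply: eq_lin => p /=; rewrite unit_row_letter.
Qed.

Definition monom_mx (m : {fmonom 'I_3}) : 'M[k]_12 := \prod_(i <- m : seq 'I_3) letter_mx i.

Fact monom_mx_mmorphism : mmorphism monom_mx.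
Proof.
split=> [x y|]; last by rewrite /monom_mx fm1 big_nil.
by rewrite /monom_mx fmM big_cat.
Qed.
HB.instance Definition _ := isMultiplicative.Build {fmonom 'I_3} 'M[k]_12 monom_mx
  monom_mx_mmorphism.

Definition free_mx (x : free3) : 'M[k]_12 := mmap (@scalar_mx k 12) monom_mx x.

Lemma free_mx_is_additive : additive free_mx.
Proof. exact: mmap_is_additive. Qed.
HB.instance Definition _ := GRing.isAdditive.Build free3 'M[k]_12 free_mx
  free_mx_is_additive.

Lemma free_mxM x y : free_mx (x * y) = free_mx x * free_mx y.
Proof.
apply: (commr_mmap_is_multiplicative _).1 => g m m'.
exact: comm_scalar_mx.
Qed.

Lemma free_mxZ (c : k) x : free_mx (c *: x) = c *: free_mx x.
Proof. by rewrite /free_mx mmapZ /= -mul_scalar_mx. Qed.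

Lemma free_mx1 : free_mx 1 = 1.
Proof. exact: mmap1. Qed.

Lemma free_mx_gen i : free_mx (FKgen k i) = letter_mx i.
Proof. by rewrite unlock /free_mx mmapU /monom_mx fmU big_seq1 mul1r. Qed.

(** Row p of a product of letter matrices is the basis word p multiplied by the letters in turn. The
    vanishing of a sum of such products is thus tested on the integer tables, uniformly in k. *)
Let word_mx_zero (rs : seq (seq nat)) :=
  all (fun p => szero (flatten
    [seq foldl (fun r g => sbind (basis_mulr g) r) [:: P p] w | w <- rs])) (iota 0 12).

Let word_mx_zeroP rs : word_mx_zero rs ->
  \sum_(w <- rs) foldl (fun A g => A * letter_mx g) 1 w = 0.
Proof.
move=> /allP rs0; apply/row_matrixP => p; rewrite row0 rowE.
have -> : delta_mx 0 p = unit_row p by apply/rowP=> j; rewrite !mxE.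
rewrite -(szeroP unit_row (rs0 p _)) ?mem_iota ?ltn_ord //.
rewrite [RHS]big_flatten big_map mulmx_sumr; apply: eq_bigr => w _.
rewrite -[RHS]/(lin unit_row _).
elim/last_ind: w => [|w g IHw] /=; first by rewrite mulmx1 lin1.
by rewrite !foldl_rcons -lin_unit_row_letter -IHw mulmxA.
Qed.

Lemma free_mxD x y : free_mx (x + y) = free_mx x + free_mx y.
Proof. exact: raddfD. Qed.

(* Not by rewriting: the search for free_mx (_ + _) would unfold products.    *)
Lemma free_mx_sum3 x1 y1 x2 y2 x3 y3 :
  free_mx (x1 * y1 + x2 * y2 + x3 * y3) =
  free_mx x1 * free_mx y1 + free_mx x2 * free_mx y2 + free_mx x3 * free_mx y3.
Proof.
apply: etrans (free_mxD _ _) (congr2 _ (etrans (free_mxD _ _) _) (free_mxM _ _)).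
exact: congr2 (free_mxM _ _) (free_mxM _ _).
Qed.

(** The multiplication table respects the defining relations, so that the representation of the free
    algebra descends to B. This is what makes the twelve words independent in B. *)
Lemma free_mx_rel r : r \in FK_rels k -> free_mx r = 0.
Proof.
rewrite /FK_rels !in_cons in_nil.
case/orP=> [/eqP->|/orP[/eqP->|/orP[/eqP->|/orP[/eqP->|/orP[/eqP->|//]]]]].
- rewrite expr2 free_mxM free_mx_gen.
  by have := @word_mx_zeroP [:: [:: 0; 0]]%N isT; rewrite big_seq1 /= mul1r.
- rewrite expr2 free_mxM free_mx_gen.
  by have := @word_mx_zeroP [:: [:: 1; 1]]%N isT; rewrite big_seq1 /= mul1r.
- rewrite expr2 free_mxM free_mx_gen.
  by have := @word_mx_zeroP [:: [:: 2; 2]]%N isT; rewrite big_seq1 /= mul1r.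
- rewrite free_mx_sum3 !free_mx_gen.
  have := @word_mx_zeroP [:: [:: 0; 1]; [:: 1; 2]; [:: 2; 0]]%N isT.
  by rewrite !big_cons big_nil /= !mul1r addr0 addrA.
- rewrite free_mx_sum3 !free_mx_gen.
  have := @word_mx_zeroP [:: [:: 1; 0]; [:: 2; 1]; [:: 0; 2]]%N isT.
  by rewrite !big_cons big_nil /= !mul1r addr0 addrA.
Qed.

Lemma free_mx_ideal x : x \in @FK_ideal k -> free_mx x = 0.
Proof.
move=> /FK_idealP[s sP ->]; rewrite raddf_sum big_seq big1 // => t /sP tP.
by rewrite /= 2!free_mxM (free_mx_rel tP) mulr0 mul0r.
Qed.

(** Word 0 is the unit, so the row 0 of the matrix of u holds the coordinates of 1 u = u. *)
Definition coords (u : B) : 'rV[k]_12 := unit_row 0 *m free_mx (repr u).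

Lemma coords_pi x : coords (FK_pi x) = unit_row 0 *m free_mx x.
Proof.
have /eqP := free_mx_ideal (FK_repr_pi x).
by rewrite free_mx_is_additive subr_eq0 /coords => /eqP->.
Qed.

Fact coords_is_linear : linear coords.
Proof.
move=> c u v; rewrite -[u]FK_reprK -[v]FK_reprK -FK_piZ -FK_piD.
by rewrite !coords_pi free_mxD free_mxZ mulmxDr scalemxAr.
Qed.
HB.instance Definition _ := GRing.isLinear.Build k B 'rV[k]_12 *:%R coords
  coords_is_linear.

Lemma coords_letter u g : coords (u * letter k g) = coords u *m letter_mx g.
Proof.
rewrite -[u]FK_reprK.
suff [x -> <-] : exists2 x, letter k g = FK_pi x & free_mx x = letter_mx g.
  by rewrite -FK_piM !coords_pi free_mxM mulmxA.
case: g => [|[|[|g]]].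
- by exists (FKgen k (@Ordinal 3 0 isT)); rewrite ?free_mx_gen.
- by exists (FKgen k (@Ordinal 3 1 isT)); rewrite ?free_mx_gen.
- by exists (FKgen k (@Ordinal 3 2 isT)); rewrite ?free_mx_gen.
exists 0; first by rewrite FK_pi0 /letter nth_default.
rewrite raddf0; apply/matrixP=> p j.
by rewrite !mxE /basis_mulr [nth _ _ g.+3]nth_default // nth_nil lin_nil mxE.
Qed.

Lemma coords_basis_word p : coords (basis_word k p) = unit_row p.
Proof.
rewrite /basis_word; case: ifP => [ltp|/negbT]; last first.
  rewrite -leqNgt => lep; rewrite linear0; apply/esym/rowP=> j; rewrite !mxE.
  by case: eqP => // jp; move: (ltn_ord j); rewrite jp ltnNge lep.
have -> (w : seq nat) : coords (foldl (fun u g => u * letter k g) 1 w) =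
    lin unit_row (foldl (fun r g => sbind (basis_mulr g) r) [:: P 0] w).
  elim/last_ind: w => [|w g IHw] /=.
    by rewrite lin1 -FK_pi1 coords_pi free_mx1 mulmx1.
  by rewrite !foldl_rcons coords_letter IHw lin_unit_row_letter.
do 12?[case: p ltp => [|p] ltp; first by apply: lin1].
by [].
Qed.

Definition of_coords (c : 'rV[k]_12) : B := \sum_(p < 12) c 0 p *: basis_word k p.

Fact of_coords_is_linear : linear of_coords.
Proof.
move=> l c c'; rewrite scaler_sumr -big_split; apply: eq_bigr => p _.
by rewrite !mxE scalerDl scalerA.
Qed.
HB.instance Definition _ := GRing.isLinear.Build k 'rV[k]_12 B *:%R of_coords
  of_coords_is_linear.

Lemma of_coords_unit p : of_coords (unit_row p) = basis_word k p.
Proof.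
have [ltp|lep] := ltnP p 12; last first.
  rewrite /basis_word ltnNge lep /= /of_coords big1 // => j _.
  by rewrite mxE; case: eqP => [jp|]; rewrite ?scale0r //; move: (ltn_ord j); rewrite jp ltnNge lep.
rewrite /of_coords (bigD1 (Ordinal ltp)) //= mxE eqxx scale1r big1 ?addr0 // => j.
by rewrite -val_eqE mxE => /negbTE /= ->; rewrite scale0r.
Qed.

Lemma of_coords_letter c g : of_coords (c *m letter_mx g) = of_coords c * letter k g.
Proof.
have -> : c = \sum_(p < 12) c 0 p *: unit_row p.
  apply/rowP=> j; rewrite summxE (bigD1 j) //= !mxE eqxx mulr1 big1 ?addr0 // => p.
  by rewrite -val_eqE !mxE eq_sym => /negbTE ->; rewrite mulr0.
rewrite mulmx_suml !linear_sum mulr_suml; apply: eq_bigr => p _.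
rewrite -scalemxAl !linearZ /= -scalerAl unit_row_letter raddf_lin of_coords_unit.
by rewrite basis_word_letter; congr (_ *: _); apply: eq_lin => q /=; rewrite of_coords_unit.
Qed.

Lemma FK_pi_gen i : FK_pi (FKgen k i) = letter k i.
Proof. by case: i => [[|[|[|//]]] lti]; congr (FK_pi (FKgen k _)); apply: val_inj. Qed.

(** Both maps intertwine right multiplication by a letter with [letter_mx], so an induction on
    monomials reduces the claim to the unit. Together with [coords_basis_word], it shows that the
    words form a basis of B. *)
Lemma coordsK : cancel coords of_coords.
Proof.
move=> u; rewrite -[u]FK_reprK; move: (repr u) => x; rewrite {u}.
rewrite [x]monalgE; elim/big_ind: _ => [|x1 x2 IH1 IH2|m _].
- by rewrite FK_pi0 !linear0.
- by rewrite FK_piD !linearD /= IH1 IH2.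
move: x@_m => c; rewrite -(fmK m); elim/last_ind: (m : seq _) => [|w i IHw] /=.
  have -> : << c *g FMonom [::] >> = c *: 1 :> free3.
    by rewrite -mul_malgC mulr1 /malgC; congr mkmalgU; apply: val_inj; rewrite /= fm1.
  rewrite FK_piZ !linearZ /= -[FK_pi 1]/(basis_word k 0).
  by rewrite coords_basis_word of_coords_unit.
have -> : << c *g FMonom (rcons w i) >> = << c *g FMonom w >> * FKgen k i :> free3.
  rewrite unlock malgM_def fgmulUU mulr1; congr mkmalgU.
  by apply: val_inj; rewrite /= fmM fmU cats1.
by rewrite FK_piM FK_pi_gen coords_letter of_coords_letter IHw.
Qed.

Lemma FK_augM u v : FK_aug (u * v) = FK_aug u * FK_aug v :> k.
Proof. by rewrite -[u]FK_reprK -[v]FK_reprK -FK_piM !FK_augE aug3M. Qed.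

Fact FK_aug_is_additive : additive (@FK_aug k).
Proof.
have augD u v : FK_aug (u + v) = FK_aug u + FK_aug v :> k.
  by rewrite -[u]FK_reprK -[v]FK_reprK -FK_piD !FK_augE aug3D.
by move=> u v; apply: (addIr (FK_aug v)); rewrite -augD !subrK.
Qed.
HB.instance Definition _ := GRing.isAdditive.Build B k (@FK_aug k) FK_aug_is_additive.

Lemma FK_augZ l u : FK_aug (l *: u) = l * FK_aug u :> k.
Proof. by rewrite -[u]FK_reprK -FK_piZ !FK_augE aug3Z. Qed.

Lemma FK_aug_letter g : FK_aug (letter k g) = 0.
Proof.
case: g => [|[|[|g]]]; rewrite /letter /= ?FK_augE ?aug3_gen //.
by rewrite nth_nil raddf0.
Qed.

Lemma FK_aug_basis_word p : FK_aug (basis_word k p) = (p == 0%N)%:R.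
Proof.
case: p => [|p]; first by rewrite /basis_word /= -FK_pi1 FK_augE aug3_1.
rewrite /basis_word; case: ifP => [ltp|_]; last exact: raddf0.
by do 11?[case: p ltp => [|p] ltp; first by rewrite /= FK_augM FK_aug_letter mulr0].
Qed.

Lemma FK_aug_coords u : FK_aug u = coords u 0 0.
Proof.
rewrite -[u in LHS]coordsK raddf_sum big_ord_recl big1 ?addr0 => [|p _] /=.
  by rewrite FK_augZ FK_aug_basis_word mulr1.
by rewrite FK_augZ FK_aug_basis_word mulr0.
Qed.

End Coordinates.

(** * The complex K *)

(** An absent key yields the zero vector, so tables list nonzero values only. *)
Definition slookup (K T : eqType) (s : seq (K * svec T)%type) (x : K) : svec T :=
  head [::] [seq t.2 | t <- s & t.1 == x].

(* Sparse vectors over pairs (i, p) stand for elements of a free FK-module:   *)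
(* the pair denotes the p-th basis word in position i.                        *)
Definition pvec := svec (nat * nat)%type.

Definition smulw (p : nat) (r : pvec) : pvec :=
  sbind (fun x => [seq ((x.1, t.1), t.2) | t <- basis_mul p x.2]) r.

(** Free left modules are made of row vectors, and linear maps multiply by matrices on the right:
    the position in x selects a row, which the word of x multiplies on the left. *)
Definition smulx (rows : seq pvec) (x : (nat * nat)%type) : pvec :=
  smulw x.2 (nth [::] rows x.1).

(** * Sparse matrices over B and k-linear maps given on words *)

Section FreeModules.
Variable k : fieldType.
Local Notation B := (FK k).

Definition word_row m (x : (nat * nat)%type) : 'rV[B]_m :=
  \row_(j < m) if j == x.1 :> nat then basis_word k x.2 else 0.

Definition sparse_mx m n (rows : seq pvec) : 'M[B]_(m, n) :=
  \matrix_(i < m) lin (word_row n) (nth [::] rows i).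

Lemma word_row_out m x : (m <= x.1)%N || (12 <= x.2)%N -> word_row m x = 0.
Proof.
move=> xout; apply/rowP=> j; rewrite !mxE; case: eqP => // jx.
case/orP: xout => [|lex]; first by rewrite -jx leqNgt ltn_ord.
by rewrite /basis_word ifN // -leqNgt.
Qed.

Lemma lin_smulw n p r :
  lin (word_row n) (smulw p r) = basis_word k p *: lin (word_row n) r.
Proof.
rewrite lin_sbind scaler_sumr; apply: eq_bigr => -[[i q] c] _ /=.
rewrite -scalerMzr.
apply: (congr1 (fun v => v *~ c)).
rewrite /lin big_map /=; apply/rowP=> j; rewrite !mxE summxE.
case: eqP => [ji|neq]; last first.
  rewrite mulr0 big1 // => t _; rewrite -scaler_int !mxE.
  by case: eqP => //; rewrite mulr0.
rewrite basis_word_mul; apply: eq_bigr => t _.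
by rewrite -scaler_int !mxE ji eqxx mulrzl.
Qed.

Lemma word_row_sparse m n rows x : (size rows <= m)%N ->
  word_row m x *m sparse_mx m n rows = lin (word_row n) (smulx rows x).
Proof.
move=> le_m; rewrite /smulx lin_smulw.
have [ltx|lex] := ltnP x.1 m; last first.
  by rewrite word_row_out ?lex // mul0mx nth_default ?lin_nil ?scaler0 ?(leq_trans le_m).
have -> : word_row m x = basis_word k x.2 *: delta_mx 0 (Ordinal ltx).
  by apply/rowP=> j; rewrite !mxE eqxx -val_eqE /=; case: eqP => _; rewrite ?mulr1 ?mulr0.
by rewrite -scalemxAl -rowE rowK.
Qed.

Lemma lin_word_row_sparse m n rows r : (size rows <= m)%N ->
  lin (word_row m) r *m sparse_mx m n rows = lin (word_row n) (sbind (smulx rows) r).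
Proof.
move=> le_m; rewrite lin_sbind /lin mulmx_suml; apply: eq_bigr => t _.
by rewrite -[LHS]/(mulmxr _ _) raddfMz /= word_row_sparse.
Qed.

Lemma sparse_mxM m n p rows rows' : (size rows' <= n)%N ->
  sparse_mx m n rows *m sparse_mx n p rows' =
  sparse_mx m p [seq sbind (smulx rows') r | r <- rows].
Proof.
move=> le_n; apply/row_matrixP => i; rewrite row_mul !rowK lin_word_row_sparse //.
have [lti|lei] := ltnP i (size rows); first by rewrite (nth_map [::]).
by rewrite !nth_default ?size_map.
Qed.

Lemma sparse_mxD m n rows rows' : size rows = size rows' ->
  sparse_mx m n rows + sparse_mx m n rows' =
  sparse_mx m n [seq r.1 ++ r.2 | r <- zip rows rows'].
Proof.
move=> eq_sz; apply/row_matrixP => i; rewrite raddfD /= !rowK -lin_cat.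
have [lti|lei] := ltnP i (size rows).
  by rewrite (nth_map ([::], [::])) ?size_zip -?eq_sz ?minnn // nth_zip.
by rewrite !nth_default ?size_map ?size_zip -?eq_sz ?minnn.
Qed.

Lemma sparse_mx_eq0 m n rows : all (@szero _) rows -> sparse_mx m n rows = 0.
Proof.
move=> /allP rows0; apply/row_matrixP => i; rewrite row0 rowK.
have [lti|lei] := ltnP i (size rows); last by rewrite nth_default ?lin_nil.
by rewrite szeroP ?rows0 ?mem_nth.
Qed.

Lemma sparse_mx_cat m1 m2 n rows1 rows2 : size rows1 = m1 ->
  sparse_mx (m1 + m2) n (rows1 ++ rows2) =
  col_mx (sparse_mx m1 n rows1) (sparse_mx m2 n rows2).
Proof.
move=> sz1; apply/matrixP => i j; case: (split_ordP i) => i' ->.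
  by rewrite col_mxEu !mxE nth_cat sz1 /= ltn_ord.
by rewrite col_mxEd !mxE nth_cat sz1 /= ltnNge leq_addr addKn.
Qed.

(** Word 0 is the only basis word of nonzero augmentation, so it suffices that it occurs in no
    row. *)
Lemma FK_aug_sparse m n rows i j :
  all (all (fun t : (nat * nat * int)%type => t.1.2 != 0%N)) rows ->
  FK_aug (sparse_mx m n rows i j) = 0.
Proof.
move=> /allP rows_pos; rewrite mxE summxE raddf_sum big_seq big1 //= => t tr.
rewrite -scaler_int !mxE FK_augM.
case: ifP => _; last by rewrite raddf0 mulr0.
have rowi : nth [::] rows i \in rows.
  by rewrite mem_nth // ltnNge; apply: contraTN tr => lei; rewrite nth_default.
by rewrite FK_aug_basis_word (negbTE (allP (rows_pos _ rowi) _ tr)) mulr0.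
Qed.

(** Only k-linearity is required, since contracting homotopies are not B-linear; such a map is
    determined by its values on the 12 m word rows. *)
Definition presents m n (F : (nat * nat)%type -> pvec) (f : 'rV[B]_m -> 'rV[B]_n) :=
  [/\ {morph f : u v / u + v},
      forall c v, f (c%:A *: v) = c%:A *: f v &
      forall x, f (word_row m x) = lin (word_row n) (F x)].

Lemma row_word_sum m (v : 'rV[B]_m) :
  v = \sum_(i < m) \sum_(p < 12) (coords (v 0 i) 0 p)%:A *: word_row m (i : nat, p : nat).
Proof.
apply/rowP => j; rewrite summxE (bigD1 j) //= [X in _ + X]big1 ?addr0 => [|i neij].
  rewrite summxE -[LHS]coordsK; apply: eq_bigr => p _.
  by rewrite !mxE eqxx mulr_algl.
rewrite summxE big1 // => p _; rewrite !mxE.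
by case: eqP => [/val_inj ji|]; rewrite ?mulr0 //; move: neij; rewrite ji eqxx.
Qed.

(** The word rows span the free module over k, so an identity between presented maps becomes a
    finite computation with integers. *)
Lemma presents_eq0 m n F (f : 'rV[B]_m -> 'rV[B]_n) : presents F f ->
  all (fun i => all (fun p => szero (F (i, p))) (iota 0 12)) (iota 0 m) ->
  forall v, f v = 0.
Proof.
move=> [fD fZ fF] /allP F0 v.
have f0 : f 0 = 0 by apply: (addrI (f 0)); rewrite -fD !addr0.
rewrite [v]row_word_sum (big_morph f fD f0) big1 // => i _.
rewrite (big_morph f fD f0) big1 // => p _.
have Fi : all (fun q => szero (F (i : nat, q))) (iota 0 12).
  by apply: F0; rewrite mem_iota ltn_ord.
by rewrite fZ fF szeroP ?scaler0 //; apply: (allP Fi); rewrite mem_iota ltn_ord.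
Qed.

Lemma presents_id m : presents (fun x => [:: (x, Posz 1)]) (@id 'rV[B]_m).
Proof. by split=> // x; rewrite lin1. Qed.

Lemma presents_comp m n p F G (f : 'rV[B]_m -> 'rV[B]_n) (g : 'rV[B]_n -> 'rV[B]_p) :
  presents F f -> presents G g -> presents (fun x => sbind G (F x)) (fun v => g (f v)).
Proof.
move=> [fD fZ fF] [gD gZ gG]; split=> [u v|c v|x]; rewrite ?fD ?gD ?fZ ?gZ //.
have g0 : g 0 = 0 by apply: (addrI (g 0)); rewrite -gD !addr0.
have gN v : g (- v) = - g v by apply: (addrI (g v)); rewrite -gD !subrr g0.
have gB : additive g by move=> u v; rewrite gD gN.
pose ga : {additive _ -> _} := HB.pack g (GRing.isAdditive.Build _ _ g gB).
by rewrite fF lin_sbind -[LHS]/(ga _) raddf_lin; apply: eq_lin => y /=; rewrite gG.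
Qed.

Lemma presents_add m n F G (f g : 'rV[B]_m -> 'rV[B]_n) :
  presents F f -> presents G g -> presents (fun x => F x ++ G x) (fun v => f v + g v).
Proof.
move=> [fD fZ fF] [gD gZ gG]; split=> [u v|c v|x].
- by rewrite fD gD addrACA.
- by rewrite fZ gZ scalerDr.
- by rewrite fF gG lin_cat.
Qed.

Lemma presents_opp m n F (f : 'rV[B]_m -> 'rV[B]_n) :
  presents F f -> presents (fun x => [seq (t.1, - t.2) | t <- F x]) (fun v => - f v).
Proof.
move=> [fD fZ fF]; split=> [u v|c v|x].
- by rewrite fD opprD.
- by rewrite fZ scalerN.
by rewrite fF /lin big_map -sumrN; apply: eq_bigr => t _; rewrite mulrNz.
Qed.

Lemma presents_mulmx m n rows : (size rows <= m)%N ->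
  presents (smulx rows) (fun v : 'rV[B]_m => v *m sparse_mx m n rows).
Proof.
move=> le_m; split=> [u v|c v|x]; last exact: word_row_sparse.
  exact: mulmxDl.
by rewrite -scalemxAl.
Qed.

Lemma coordsD (u v : B) i p : coords (u + v) i p = coords u i p + coords v i p.
Proof. by rewrite linearD mxE. Qed.

Lemma coordsZ c (u : B) i p : coords (c *: u) i p = c * coords u i p.
Proof. by rewrite linearZ mxE. Qed.

Lemma coords0 i p : coords (0 : B) i p = 0.
Proof. by rewrite linear0 mxE. Qed.

Definition table_map m n (S : seq (nat * nat * pvec)%type) (v : 'rV[B]_m) : 'rV[B]_n :=
  \sum_(i < m) \sum_(p < 12) (coords (v 0 i) 0 p)%:A *:
    lin (word_row n) (slookup S (i : nat, p : nat)).

Lemma presents_table m n S : all (fun t => (t.1.1 < m)%N && (t.1.2 < 12)%N) S ->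
  presents (slookup S) (@table_map m n S).
Proof.
move=> /allP Sin; split=> [u v|c v|x].
- rewrite -big_split; apply: eq_bigr => i _; rewrite -big_split; apply: eq_bigr => p _.
  by rewrite (mxE _ _ 0 i) coordsD !scalerDl.
- rewrite scaler_sumr; apply: eq_bigr => i _; rewrite scaler_sumr; apply: eq_bigr => p _.
  by rewrite (mxE _ _ 0 i) mulr_algl coordsZ scalerA mulr_algl scalerA.
(* Out of range, [word_row] is zero and the hypothesis on the keys makes the lookup empty. *)
have [xin|] := boolP ((x.1 < m)%N && (x.2 < 12)%N); last first.
  move=> xout; have -> : slookup S x = [::].
    rewrite /slookup; have -> : [seq t <- S | t.1 == x] = [::]; last by [].
    apply/eqP; rewrite -[_ == _]negbK -has_filter; apply/hasPn=> t /Sin tin.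
    by apply: contraNN xout => /eqP <-.
  rewrite lin_nil word_row_out; last by move: xout; rewrite negb_and -!leqNgt.
  apply: big1 => i _; apply: big1 => p _.
  by rewrite (mxE _ _ 0 i) coords0 !scale0r.
case: x xin => i p /= /andP[lti ltp].
rewrite /table_map (bigD1 (Ordinal lti)) //= [X in _ + X]big1 ?addr0; last first.
  move=> j; rewrite -val_eqE /= => /negbTE neji; apply: big1 => q _.
  by rewrite [word_row _ _ 0 j]mxE neji coords0 !scale0r.
rewrite (bigD1 (Ordinal ltp)) //= [X in _ + X]big1 ?addr0; last first.
  move=> q; rewrite -val_eqE /= => /negbTE neqp.
  by rewrite [word_row _ _ 0 _]mxE eqxx coords_basis_word mxE neqp !scale0r.
by rewrite [word_row _ _ 0 _]mxE eqxx coords_basis_word mxE eqxx !scale1r.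
Qed.

End FreeModules.

(** * Differentials, gluing maps and homotopies as sparse data *)

Local Notation T i p r := ((i%N, p%N), r).

(** The words numbered 1, 2 and 6 are the letters a, b and c. *)
Definition d1_rows : seq pvec :=
  [:: [:: P (0,1)];
      [:: P (0,2)];
      [:: P (0,6)]].

(* The rows correspond to a^2, b^2, c^2, ba + cb + ac and ca + ab + bc.        *)
Definition d2_rows : seq pvec :=
  [:: [:: P (0,1)];
      [:: P (1,2)];
      [:: P (2,6)];
      [:: P (0,2); P (1,6); P (2,1)];
      [:: P (0,6); P (1,1); P (2,2)]].

Definition d3_rows : seq pvec :=
  [:: [:: P (0,1)];
      [:: P (1,2)];
      [:: P (2,6)];
      [:: P (0,1); P (1,1); P (2,1); P (3,2); P (4,6)];
      [:: P (0,2); P (1,2); P (2,2); P (3,6); P (4,1)];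
      [:: P (0,6); P (1,6); P (2,6); P (3,1); P (4,2)]].

Definition d4_rows : seq pvec :=
  [:: [:: P (0,1)];
      [:: P (1,2)];
      [:: P (2,6)];
      [:: P (3,1); P (4,2); P (5,6)];
      [:: P (3,2); P (4,6); P (5,1)];
      [:: P (3,6); P (4,1); P (5,2)]].

(** This row is a cycle of K_3 whose class spans the extra homology. The maps f_1, f_2 and f_3
    extend it to higher degrees, anticommuting with the differentials; f_3 serves from degree 3
    on. *)
Definition f0_rows : seq pvec :=
  [:: [:: P (0,10); P (1,9); M (2,5); P (5,5)]].

Definition f1_rows : seq pvec :=
  [:: [:: P (0,10)];
      [:: P (1,9)];
      [:: M (2,5); M (4,10)]].

Definition f2_rows : seq pvec :=
  [:: [:: P (0,10)];
      [:: P (1,9)];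
      [:: M (2,5)];
      [:: M (0,9); P (1,5); M (3,9)];
      [:: M (2,9)]].

Definition f3_rows : seq pvec :=
  [:: [:: P (0,10)];
      [:: P (1,9)];
      [:: M (2,5)];
      [:: M (3,10)];
      [::];
      [::]].

(* The tables satisfy v = g_n (v *m d_n) + h_n v *m d_{n+1} for v of degree n; *)
(* in degree 3, f_0 is put on top of d_4.                                      *)
Definition h0_table : seq (nat * nat * pvec)%type :=
  [:: T 0 1 [:: P (0,0)]; T 0 2 [:: P (1,0)]; T 0 3 [:: P (1,1)]; T 0 4 [:: P (0,2)];
      T 0 5 [:: P (1,4)]; T 0 6 [:: P (2,0)]; T 0 7 [:: P (2,1)]; T 0 8 [:: P (2,2)];
      T 0 9 [:: P (2,3)]; T 0 10 [:: M (1,8)]; T 0 11 [:: P (2,5)]].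

Definition g1_table : seq (nat * nat * pvec)%type :=
  [:: T 0 1 [:: P (0,0)]; T 0 2 [:: P (1,0)]; T 0 3 [:: P (1,1)];
      T 0 4 [:: M (1,6); M (2,1)]; T 0 5 [:: M (1,7)]; T 0 6 [:: P (2,0)];
      T 0 7 [:: P (2,1)]; T 0 8 [:: P (2,2)]; T 0 9 [:: M (0,7)]; T 0 10 [:: P (2,4)];
      T 0 11 [:: P (2,5)]].

Definition h1_table : seq (nat * nat * pvec)%type :=
  [:: T 0 1 [:: P (0,0)]; T 0 2 [:: P (3,0)]; T 0 3 [:: P (3,1)]; T 0 4 [:: P (0,2)];
      T 0 5 [:: M (0,8)]; T 0 6 [:: P (4,0)]; T 0 8 [:: P (1,6); P (4,2)];
      T 0 9 [:: M (0,7)]; T 0 10 [:: M (3,8)]; T 0 11 [:: M (3,9)]; T 1 2 [:: P (1,0)];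
      T 1 3 [:: P (1,1)]; T 1 4 [:: M (1,6)]; T 1 5 [:: M (1,7)]; T 1 8 [:: P (3,2)];
      T 1 9 [:: M (4,7)]; T 1 10 [:: P (0,8); P (3,4)]; T 1 11 [:: M (1,9)];
      T 2 3 [:: P (4,1)]; T 2 6 [:: P (2,0)]; T 2 7 [:: P (2,1)]; T 2 8 [:: P (2,2)];
      T 2 9 [:: P (2,3)]; T 2 10 [:: P (2,4)]; T 2 11 [:: P (2,5)]].

Definition g2_table : seq (nat * nat * pvec)%type :=
  [:: T 0 1 [:: P (0,0)]; T 0 2 [:: P (3,0)]; T 0 3 [:: P (3,1)]; T 0 4 [:: P (0,2)];
      T 0 5 [:: M (0,8)]; T 0 6 [:: P (4,0)]; T 0 7 [:: P (4,1)];
      T 0 8 [:: M (0,6); M (3,1)]; T 0 9 [:: M (0,7)]; T 0 10 [:: P (4,4)];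
      T 0 11 [:: P (4,5)]; T 1 2 [:: P (1,0)]; T 1 3 [:: P (1,1)]; T 1 4 [:: M (1,6)];
      T 1 5 [:: M (1,7)]; T 1 8 [:: P (3,2)]; T 1 9 [:: P (3,3)]; T 1 10 [:: M (1,8)];
      T 1 11 [:: P (3,5)]; T 2 6 [:: P (2,0)]; T 2 7 [:: P (2,1)];
      T 2 8 [:: M (0,2); M (3,6); M (4,1)]; T 2 9 [:: P (2,3)]; T 2 10 [:: P (2,4)];
      T 2 11 [:: M (3,10)]].

Definition h2_table : seq (nat * nat * pvec)%type :=
  [:: T 0 1 [:: P (0,0)]; T 0 3 [:: M (0,6)]; T 0 4 [:: P (0,2)]; T 0 5 [:: P (0,3)];
      T 0 9 [:: M (0,7)]; T 0 10 [:: P (1,8); M (2,4); M (4,8)]; T 0 11 [:: M (0,10)];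
      T 1 2 [:: P (1,0)]; T 1 3 [:: P (1,1)]; T 1 4 [:: M (1,6)]; T 1 5 [:: M (1,7)];
      T 1 9 [:: P (0,7); M (2,3); M (3,7)]; T 1 10 [:: M (1,8)];
      T 1 11 [:: P (0,10); M (2,5); P (5,5)]; T 2 2 [:: M (1,0); P (4,0)];
      T 2 5 [:: M (0,3); P (1,7); P (4,4)]; T 2 6 [:: P (2,0)]; T 2 7 [:: P (2,1)];
      T 2 8 [:: P (2,2)]; T 2 9 [:: P (2,3)]; T 2 10 [:: P (2,4)]; T 2 11 [:: P (2,5)];
      T 3 4 [:: M (2,2); M (3,6); M (4,1)]; T 3 7 [:: P (0,6); M (1,1); P (4,1)];
      T 3 8 [:: P (4,2)]; T 3 9 [:: P (4,3)]; T 3 11 [:: M (5,10)];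
      T 4 2 [:: M (2,0); P (5,0)]; T 4 3 [:: M (2,1); M (3,2); M (4,6)];
      T 4 6 [:: M (0,0); P (3,0)]; T 4 7 [:: M (4,2); M (5,6)];
      T 4 8 [:: M (0,2); P (1,6); P (3,2)]; T 4 9 [:: M (4,4); M (4,7)];
      T 4 10 [:: P (3,4)]; T 4 11 [:: M (5,9)]].

Definition g3_table : seq (nat * nat * pvec)%type :=
  [:: T 0 1 [:: P (0,0)]; T 0 2 [:: M (1,0); P (4,0)]; T 0 3 [:: M (1,1); P (4,1)];
      T 0 4 [:: P (0,2)]; T 0 5 [:: M (0,8)]; T 0 6 [:: M (2,0); P (5,0)];
      T 0 7 [:: M (0,2); P (1,6); M (2,1); M (4,6)];
      T 0 8 [:: M (0,6); P (1,1); M (4,1)]; T 0 9 [:: M (0,7)];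
      T 0 10 [:: P (1,8); M (2,4); M (4,8)]; T 0 11 [:: M (0,10)];
      T 1 1 [:: M (0,0); P (3,0)]; T 1 2 [:: P (1,0)]; T 1 3 [:: P (1,1)];
      T 1 4 [:: M (0,2); P (3,2)]; T 1 5 [:: P (1,4)];
      T 1 7 [:: P (0,2); M (1,6); M (3,2)];
      T 1 8 [:: P (0,6); M (1,1); M (2,2); M (3,6)];
      T 1 9 [:: P (0,7); M (2,3); P (5,3); P (5,8)]; T 1 10 [:: M (1,8)];
      T 1 11 [:: M (1,9)]; T 2 5 [:: P (0,8); M (1,4); M (4,7)]; T 2 6 [:: P (2,0)];
      T 2 7 [:: P (2,1)]; T 2 8 [:: P (2,2)]; T 2 9 [:: P (2,3)]; T 2 10 [:: P (2,4)];
      T 2 11 [:: P (0,10); P (1,9); P (5,5)]; T 3 3 [:: P (3,1)]; T 3 5 [:: M (5,8)];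
      T 3 8 [:: P (4,2)]; T 3 9 [:: P (4,3)]; T 3 10 [:: M (3,8); P (4,7)];
      T 3 11 [:: P (4,5)]; T 4 11 [:: P (3,5)]].

Definition h3_table : seq (nat * nat * pvec)%type :=
  [:: T 0 1 [:: P (1,0)]; T 0 3 [:: M (1,6)]; T 0 4 [:: P (1,2)]; T 0 5 [:: M (1,8)];
      T 0 9 [:: M (1,7)]; T 0 11 [:: M (1,10)]; T 1 2 [:: P (2,0)]; T 1 3 [:: P (2,1)];
      T 1 5 [:: P (2,4)]; T 1 7 [:: M (2,6)]; T 1 10 [:: M (2,8)]; T 1 11 [:: M (2,9)];
      T 2 5 [:: M (0,0)]; T 2 6 [:: P (3,0)]; T 2 7 [:: P (3,1)]; T 2 8 [:: P (3,2)];
      T 2 9 [:: P (3,3)]; T 2 10 [:: P (3,4)]; T 2 11 [:: P (3,5)]; T 3 3 [:: P (5,1)];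
      T 3 4 [:: P (4,2)]; T 3 7 [:: P (6,1)]; T 3 9 [:: P (6,3)]; T 3 10 [:: P (6,4)];
      T 3 11 [:: P (6,5)]; T 4 4 [:: M (4,6); M (5,1)]; T 4 9 [:: M (6,7)];
      T 4 10 [:: P (5,4)]; T 4 11 [:: M (6,10)]; T 5 1 [:: P (5,0)]; T 5 2 [:: P (6,0)];
      T 5 4 [:: P (5,2)]; T 5 6 [:: P (4,0)]; T 5 7 [:: P (4,1)]; T 5 9 [:: P (4,3)];
      T 5 10 [:: P (4,4)]; T 5 11 [:: P (4,5)]].

Definition g4_table : seq (nat * nat * pvec)%type :=
  [:: T 0 1 [:: P (0,0)]; T 0 3 [:: M (0,6)]; T 0 4 [:: P (0,2)]; T 0 5 [:: P (0,3)];
      T 0 9 [:: M (0,7)]; T 0 11 [:: M (0,10)]; T 1 2 [:: P (1,0)]; T 1 3 [:: P (1,1)];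
      T 1 4 [:: M (1,6)]; T 1 5 [:: P (1,4)]; T 1 10 [:: M (1,8)]; T 1 11 [:: M (1,9)];
      T 2 6 [:: P (2,0)]; T 2 7 [:: P (2,1)]; T 2 8 [:: P (2,2)]; T 2 9 [:: P (2,3)];
      T 2 10 [:: P (2,4)]; T 2 11 [:: P (2,5)]; T 3 1 [:: P (3,0)]; T 3 2 [:: P (4,0)];
      T 3 3 [:: P (4,1)]; T 3 4 [:: P (3,2)]; T 3 5 [:: P (3,3)]; T 3 6 [:: P (5,0)];
      T 3 7 [:: P (5,1)]; T 3 8 [:: P (5,2)]; T 3 9 [:: P (5,3); P (5,8)];
      T 3 10 [:: P (5,4)]; T 3 11 [:: P (5,5)]; T 4 3 [:: M (4,2); M (5,6)];
      T 4 5 [:: M (5,8)]; T 4 8 [:: P (4,2)]; T 4 9 [:: M (5,7)];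
      T 4 10 [:: M (3,3); P (4,4)]; T 4 11 [:: P (4,5)]; T 5 11 [:: M (5,9)]].

Definition h4_table : seq (nat * nat * pvec)%type :=
  [:: T 0 1 [:: P (0,0)]; T 0 4 [:: P (0,2)]; T 0 5 [:: M (0,8)]; T 0 8 [:: M (0,6)];
      T 0 9 [:: M (0,7)]; T 0 11 [:: M (0,10)]; T 1 2 [:: P (1,0)]; T 1 3 [:: P (1,1)];
      T 1 5 [:: M (1,7)]; T 1 7 [:: M (1,6)]; T 1 10 [:: M (1,8)]; T 1 11 [:: M (1,9)];
      T 2 6 [:: P (2,0)]; T 2 7 [:: P (2,1)]; T 2 8 [:: P (2,2)]; T 2 9 [:: P (2,3)];
      T 2 10 [:: P (2,4)]; T 2 11 [:: P (2,5)]; T 3 1 [:: P (3,0)]; T 3 4 [:: P (3,2)];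
      T 3 5 [:: M (4,7)]; T 3 6 [:: P (5,0)]; T 3 7 [:: P (5,1)]; T 3 8 [:: P (5,2)];
      T 3 9 [:: M (3,7)]; T 3 10 [:: M (4,8)]; T 3 11 [:: M (3,10)]; T 4 3 [:: P (3,1)];
      T 4 6 [:: P (4,0)]; T 4 7 [:: P (4,1)]; T 4 8 [:: P (4,2)]; T 4 9 [:: M (5,7)];
      T 4 10 [:: M (3,8); P (4,7)]; T 4 11 [:: P (4,5)]; T 5 10 [:: P (3,4)];
      T 5 11 [:: P (3,5)]].

Definition lambda_table : seq (nat * nat * pvec)%type :=
  [:: T 2 5 [:: M (0,0)]].

(** * Verification of the identities and of the exactness of K *)

Section KoszulChecks.
Variable k : fieldType.
Local Notation B := (FK k).
Local Notation smx := (@sparse_mx k).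

Definition koszul1 : 'M[B]_(3, 1) := smx 3 1 d1_rows.
Definition koszul2 : 'M[B]_(5, 3) := smx 5 3 d2_rows.
Definition koszul3 : 'M[B]_(6, 5) := smx 6 5 d3_rows.
Definition koszul4 : 'M[B]_6 := smx 6 6 d4_rows.
Definition glue0 : 'M[B]_(1, 6) := smx 1 6 f0_rows.
Definition glue1 : 'M[B]_(3, 6) := smx 3 6 f1_rows.
Definition glue2 : 'M[B]_(5, 6) := smx 5 6 f2_rows.
Definition glue3 : 'M[B]_6 := smx 6 6 f3_rows.

Let mul_eq0 m n p rows rows' : (size rows' <= n)%N ->
  all (fun r => szero (sbind (smulx rows') r)) rows -> smx m n rows *m smx n p rows' = 0.
Proof. by move=> le_n rows0; rewrite sparse_mxM // sparse_mx_eq0 // all_map. Qed.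

Let mul_add_eq0 m n n' p rows1 rows2 rows3 rows4 :
    (size rows2 <= n)%N -> (size rows4 <= n')%N -> size rows1 = size rows3 ->
  all (fun r => szero (sbind (smulx rows2) r.1 ++ sbind (smulx rows4) r.2))
    (zip rows1 rows3) ->
  smx m n rows1 *m smx n p rows2 + smx m n' rows3 *m smx n' p rows4 = 0.
Proof.
move=> le_n le_n' eq_sz rows0; rewrite !sparse_mxM // sparse_mxD ?size_map //.
apply: sparse_mx_eq0; rewrite all_map.
have -> : zip [seq sbind (smulx rows2) r | r <- rows1] [seq sbind (smulx rows4) r | r <- rows3]
  = [seq (sbind (smulx rows2) r.1, sbind (smulx rows4) r.2) | r <- zip rows1 rows3].
  elim: rows1 rows3 {eq_sz rows0} => [|r1 rows1 IH] [|r3 rows3] //=.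
  by rewrite IH.
by rewrite all_map.
Qed.

Lemma koszul21 : koszul2 *m koszul1 = 0. Proof. by apply: mul_eq0; vm_compute. Qed.
Lemma koszul32 : koszul3 *m koszul2 = 0. Proof. by apply: mul_eq0; vm_compute. Qed.
Lemma koszul43 : koszul4 *m koszul3 = 0. Proof. by apply: mul_eq0; vm_compute. Qed.
Lemma koszul44 : koszul4 *m koszul4 = 0. Proof. by apply: mul_eq0; vm_compute. Qed.

Lemma glue0_koszul : glue0 *m koszul3 = 0. Proof. by apply: mul_eq0; vm_compute. Qed.
Lemma koszul_glue1 : koszul1 *m glue0 + glue1 *m koszul4 = 0.
Proof. by apply: mul_add_eq0; vm_compute. Qed.
Lemma koszul_glue2 : koszul2 *m glue1 + glue2 *m koszul4 = 0.
Proof. by apply: mul_add_eq0; vm_compute. Qed.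
Lemma koszul_glue3 : koszul3 *m glue2 + glue3 *m koszul4 = 0.
Proof. by apply: mul_add_eq0; vm_compute. Qed.
Lemma koszul_glue4 : koszul4 *m glue3 + glue3 *m koszul4 = 0.
Proof. by apply: mul_add_eq0; vm_compute. Qed.

(* Entries of degree 3, whereas B vanishes in degree 6.                       *)
Lemma glue03 : glue0 *m glue3 = 0. Proof. by apply: mul_eq0; vm_compute. Qed.
Lemma glue13 : glue1 *m glue3 = 0. Proof. by apply: mul_eq0; vm_compute. Qed.
Lemma glue23 : glue2 *m glue3 = 0. Proof. by apply: mul_eq0; vm_compute. Qed.
Lemma glue33 : glue3 *m glue3 = 0. Proof. by apply: mul_eq0; vm_compute. Qed.

(** The augmentation is followed by the inclusion of k into B, so that it becomes a k-linear map
    between free modules and can be given by a table. *)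
Definition aug_row (u : 'rV[B]_1) : 'rV[B]_1 := table_map 1 [:: T 0 0 [:: P (0,0)]] u.

Lemma aug_rowE u : aug_row u = (FK_aug (u 0 0))%:A *: word_row k 1 (0, 0)%N.
Proof.
rewrite /aug_row /table_map big_ord1 big_ord_recl big1 ?addr0 => [|p _].
  by rewrite FK_aug_coords /slookup /= lin1.
by rewrite /slookup /= lin_nil scaler0.
Qed.

Lemma aug_row_eq0 u : (aug_row u == 0) = (FK_aug (u 0 0) == 0).
Proof.
apply/eqP/eqP => [|u0]; last by rewrite aug_rowE u0 !scale0r.
move/rowP/(_ 0); rewrite aug_rowE !mxE eqxx /basis_word /= mulr1 => /(congr1 (@FK_aug k)).
by rewrite raddf0 FK_augZ -FK_pi1 FK_augE aug3_1 mulr1.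
Qed.

(** The check on words is the identity g (v d) + (h v) d' - v = 0, the entry with coefficient -1
    standing for - v. On a cycle the first term drops out, which leaves [h v] as a preimage. *)
Let homotopy m n1 n2 rows1 rows2 g h :
    (size rows1 <= m)%N -> (size rows2 <= n2)%N ->
    all (fun t => (t.1.1 < n1)%N && (t.1.2 < 12)%N) g ->
    all (fun t => (t.1.1 < m)%N && (t.1.2 < 12)%N) h ->
    all (fun i => all (fun p => szero (sbind (slookup g) (smulx rows1 (i, p)) ++
      sbind (smulx rows2) (slookup h (i, p)) ++ [:: M (i, p)])) (iota 0 12)) (iota 0 m) ->
  forall v : 'rV[B]_m, v *m smx m n1 rows1 = 0 -> exists w, v = w *m smx n2 m rows2.
Proof.
move=> le1 le2 gin hin chk v v0; exists (table_map n2 h v).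
have G := presents_comp (presents_mulmx k n1 le1) (presents_table k m gin).
have H := presents_comp (presents_table k n2 hin) (presents_mulmx k m le2).
have := presents_eq0 (presents_add G (presents_add H (presents_opp (presents_id k m)))) chk v.
have g0 : table_map m g (0 : 'rV[B]_n1) = 0.
  rewrite /table_map big1 // => i _; rewrite big1 // => p _.
  by rewrite (mxE _ _ 0 i) coords0 !scale0r.
by rewrite /= v0 g0 add0r => /eqP; rewrite subr_eq0 => /eqP.
Qed.

Lemma koszul_exact1 (v : 'rV[B]_3) : v *m koszul1 = 0 -> exists w, v = w *m koszul2.
Proof. by apply: (@homotopy _ _ _ _ _ g1_table h1_table); vm_compute. Qed.

Lemma koszul_exact2 (v : 'rV[B]_5) : v *m koszul2 = 0 -> exists w, v = w *m koszul3.
Proof. by apply: (@homotopy _ _ _ _ _ g2_table h2_table); vm_compute. Qed.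

Lemma koszul_exact3 (v : 'rV[B]_6) :
  v *m koszul3 = 0 -> exists w, v = w *m col_mx glue0 koszul4.
Proof.
(* Row 0 of the stacked matrix is f_0, so row i of d_4 has index i + 1 in [h3_table]. *)
have -> : col_mx glue0 koszul4 = smx (1 + 6) 6 (f0_rows ++ d4_rows).
  by rewrite sparse_mx_cat.
by apply: (@homotopy 6 5 7 _ _ g3_table h3_table); vm_compute.
Qed.

Lemma koszul_exact4 (v : 'rV[B]_6) : v *m koszul4 = 0 -> exists w, v = w *m koszul4.
Proof. by apply: (@homotopy _ _ _ _ _ g4_table h4_table); vm_compute. Qed.

(** In degree 0 the augmentation takes the place of g (v d): the identity checked is u = aug u +
    (h_0 u) d_1. *)
Lemma koszul_exact0 (u : 'rV[B]_1) : FK_aug (u 0 0) = 0 -> exists w, u = w *m koszul1.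
Proof.
move=> /eqP; rewrite -aug_row_eq0 => /eqP u0; exists (table_map 3 h0_table u).
have E := presents_add (presents_table k 1 (m := 1) (S := [:: T 0 0 [:: P (0,0)]]) isT)
  (presents_add (presents_comp (presents_table k 3 (m := 1) (S := h0_table) isT)
     (presents_mulmx k 1 (m := 3) (rows := d1_rows) isT))
   (presents_opp (presents_id k 1))).
have /(_ u) := presents_eq0 E isT.
by rewrite -/(aug_row u) u0 add0r => /eqP; rewrite subr_eq0 => /eqP.
Qed.

(* lambda_table presents a functional on the degree 3 module which vanishes   *)
(* on the boundaries and separates the class of glue0 from zero.              *)
Lemma glue0_ker (u : 'rV[B]_1) (v : 'rV[B]_6) :
  u *m glue0 + v *m koszul4 = 0 -> FK_aug (u 0 0) = 0.
Proof.
have L := presents_table k 1 (m := 6) (S := lambda_table) isT.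
have U := presents_add (presents_comp (presents_mulmx k 6 (m := 1) (rows := f0_rows) isT) L)
  (presents_opp (presents_table k 1 (m := 1) (S := [:: T 0 0 [:: P (0,0)]]) isT)).
(* [U] expresses that lambda (u f_0) is the augmentation of u: the coefficient -1 of [lambda_table]
   meets the coefficient -1 of aba in position 2 of f_0. [V] expresses that lambda vanishes on the
   image of d_4. *)
have V := presents_comp (presents_mulmx k 6 (m := 6) (rows := d4_rows) isT) L.
have /(_ u)/eqP := presents_eq0 U isT; rewrite subr_eq0 => /eqP Uu.
have Vv := presents_eq0 V isT v.
move=> uv0; apply/eqP; rewrite -aug_row_eq0 /aug_row -Uu.
case: L => Ladd _ _; have := Ladd (u *m glue0) (v *m koszul4).
rewrite uv0 Vv addr0 => <-; apply/eqP; apply: (addrI (table_map 1 lambda_table (0 : 'rV[B]_6))).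
by rewrite -Ladd !addr0.
Qed.

End KoszulChecks.

(** * The minimal resolution *)

Section Resolution.
Variable k : fieldType.
Local Notation B := (FK k).

(* The component P_{n+1} -> K_{n+4} of FK_diff n.+4; it is zero on all the     *)
(* summands of P_{n+1} but the last one.                                      *)
Definition FK_glue n : 'M[B]_(FK_N n.+1, 6) :=
  match n return 'M[B]_(FK_N n.+1, 6) with
  | 0 => glue1 k
  | 1 => glue2 k
  | 2 => glue3 k
  | m.+3 => col_mx (0 : 'M_(FK_N m, 6)) (glue3 k)
  end.

(** For P_{n+5} = P_{n+1} + K_{n+5} the differential is block triangular: a row (u, w) goes to (u d,
    u f + w d_4). From P_4 = P_0 + K_4 the target is K_3 alone, whence a single column of blocks. *)
Fixpoint FK_diff n : 'M[B]_(FK_N n.+1, FK_N n) :=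
  match n return 'M[B]_(FK_N n.+1, FK_N n) with
  | 0 => koszul1 k
  | 1 => koszul2 k
  | 2 => koszul3 k
  | 3 => col_mx (glue0 k) (koszul4 k)
  | m.+4 => block_mx (FK_diff m) (FK_glue m) (0 : 'M_(6, FK_N m)) (koszul4 k)
  end.

(** Gluing twice gives the cross term between summands two steps apart, which has to vanish in
    [FK_diff_glue]. *)
Lemma FK_glue_glue3 n : FK_glue n *m glue3 k = 0.
Proof.
case: n => [|[|[|n]]]; [exact: glue13|exact: glue23|exact: glue33|].
by rewrite /= mul_col_mx mul0mx glue33 col_mx0.
Qed.

Lemma FK_diff_glue n : FK_diff n.+1 *m FK_glue n + FK_glue n.+1 *m koszul4 k = 0.
Proof.
case: n => [|[|[|n]]]; [exact: koszul_glue2|exact: koszul_glue3| |].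
  rewrite /= !mul_col_mx glue03 mul0mx add_col_mx addr0 koszul_glue4.
  exact: col_mx0.
rewrite /= mul_block_col mul_col_mx !mulmx0 mul0mx !add0r add_col_mx.
by rewrite addr0 FK_glue_glue3 koszul_glue4 col_mx0.
Qed.

Lemma FK_diff_comp n : FK_diff n.+1 *m FK_diff n = 0.
Proof.
(* [FK_diff] recurs with step 4, so the induction carries four consecutive degrees. *)
suff: FK_diff n.+1 *m FK_diff n = 0 /\ FK_diff n.+2 *m FK_diff n.+1 = 0 by case.
suff: FK_diff n.+1 *m FK_diff n = 0 /\ FK_diff n.+2 *m FK_diff n.+1 = 0 /\
      FK_diff n.+3 *m FK_diff n.+2 = 0 /\ FK_diff n.+4 *m FK_diff n.+3 = 0 by case=> ? [].
elim: n => [|n [IH0 [IH1 [IH2 IH3]]]].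
  split; first exact: koszul21.
  split; first exact: koszul32.
  split; rewrite /=.
    by rewrite mul_col_mx glue0_koszul koszul43 col_mx0.
  by rewrite mul_block_col mul0mx add0r koszul44 koszul_glue1 col_mx0.
do 3!split=> //.
rewrite -[LHS]/(block_mx (FK_diff n.+1) (FK_glue n.+1) (0 : 'M_(6, FK_N n.+1)) (koszul4 k)
  *m block_mx (FK_diff n) (FK_glue n) (0 : 'M_(6, FK_N n)) (koszul4 k)).
rewrite mulmx_block IH0 koszul44 !mul0mx !mulmx0 !addr0 FK_diff_glue.
exact: block_mx0.
Qed.

Lemma FK_diff_exact0 (u : 'rV[B]_1) :
  FK_aug (u 0 0) = 0 <-> exists w, u = w *m FK_diff 0.
Proof.
split=> [|[w ->]]; first exact: koszul_exact0.
rewrite mxE raddf_sum big1 // => i _.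
by rewrite /= FK_augM FK_aug_sparse ?mulr0.
Qed.

(** Let (u, w) be a cycle in the sum of a shifted copy of P and a term of K. Then u is a cycle of P,
    hence u = u' d by induction; by anticommutation w - u' f is a cycle of K, and K is exact
    there. *)
Lemma FK_diff_exact n (v : 'rV[B]_(FK_N n.+1)) :
  v *m FK_diff n = 0 <-> exists w, v = w *m FK_diff n.+1.
Proof.
split=> [|[w ->]]; last by rewrite -mulmxA FK_diff_comp mulmx0.
have [m] := ubnP n; elim: m n v => // m IHm n v lt_nm.
case: n v lt_nm => [|[|[|[|n]]]] v lt_nm.
- exact: koszul_exact1.
- exact: koszul_exact2.
- exact: koszul_exact3.
- move: (v : 'rV_(1 + 6)) => {}v; rewrite -[v]hsubmxK.
  set u := lsubmx v; set w := rsubmx v.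
  rewrite [FK_diff 3]/= (mul_row_col u w) => uw0.
  (* Here u lies in P_0, which carries no cycle condition of its own; the nonzero class of f_0
     forces its augmentation to vanish instead. *)
  have /FK_diff_exact0[u' uE] := glue0_ker uw0.
  have /koszul_exact4[w' wE] : (w - u' *m FK_glue 0) *m koszul4 k = 0.
    rewrite mulmxBl -mulmxA; move: uw0; rewrite uE -mulmxA.
    have /eqP := koszul_glue1 k; rewrite addr_eq0 => /eqP ->.
    by rewrite mulmxN addrC.
  exists (row_mx u' w' : 'rV_(3 + 6)).
  rewrite [FK_diff 4]/= (mul_row_block u' w') mulmx0 addr0 -uE -wE.
  by rewrite addrC subrK.
- move: (v : 'rV_(FK_N n.+1 + 6)) => {}v; rewrite -[v]hsubmxK.
  set u := lsubmx v; set w := rsubmx v.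
  rewrite [FK_diff n.+4]/= (mul_row_block u w) mulmx0 addr0 => uw0.
  have /eq_row_mx[u0 w0] : row_mx (u *m FK_diff n) (u *m FK_glue n + w *m koszul4 k) =
     row_mx 0 0 by rewrite uw0 row_mx0.
  have lt_n : (n < m)%N.
    by move: lt_nm; rewrite ltnS; apply: leq_trans; rewrite ltnS -addn3 leq_addr.
  have [u' uE] := IHm n u lt_n u0.
  have /koszul_exact4[w' wE] : (w - u' *m FK_glue n.+1) *m koszul4 k = 0.
    rewrite mulmxBl -mulmxA; move: w0; rewrite {1}uE -mulmxA.
    have /eqP := FK_diff_glue n; rewrite addr_eq0 => /eqP ->.
    by rewrite mulmxN addrC.
  exists (row_mx u' w' : 'rV_(FK_N n.+2 + 6)).
  rewrite [FK_diff n.+4.+1]/= (mul_row_block u' w') mulmx0 addr0 -uE -wE.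
  by rewrite addrC subrK.
Qed.

Lemma FK_aug_glue n i j : FK_aug (FK_glue n i j) = 0.
Proof.
case: n i => [|[|[|n]]] i; try by apply: FK_aug_sparse.
rewrite /=; move: (i : 'I_(FK_N n + 6)) => {}i.
case: (split_ordP i) => i' ->; first by rewrite col_mxEu mxE raddf0.
by rewrite col_mxEd FK_aug_sparse.
Qed.

(** This is the minimality of the resolution: linear maps to the trivial module see entries through
    their augmentation only, and so kill all boundaries. *)
Lemma FK_aug_diff n i j : FK_aug (FK_diff n i j) = 0.
Proof.
have [m] := ubnP n; elim: m n i j => // m IHm n i j lt_nm.
case: n i j lt_nm => [|[|[|[|n]]]] i j lt_nm; try by apply: FK_aug_sparse.
  rewrite /=; move: (i : 'I_(1 + 6)) => {}i.
  case: (split_ordP i) => i' ->; first by rewrite col_mxEu FK_aug_sparse.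
  by rewrite col_mxEd FK_aug_sparse.
rewrite /=; move: (i : 'I_(FK_N n.+1 + 6)) (j : 'I_(FK_N n + 6)) => {}i {}j.
case: (split_ordP i) => i' ->; case: (split_ordP j) => j' ->.
- rewrite block_mxEul; apply: IHm; move: lt_nm; rewrite ltnS.
  by apply: leq_trans; rewrite ltnS -addn3 leq_addr.
- by rewrite block_mxEur FK_aug_glue.
- by rewrite block_mxEdl mxE raddf0.
- by rewrite block_mxEdr FK_aug_sparse.
Qed.

(** * Projectivity, maps to k and the resolution *)

Lemma free_row_projective m : projective 'rV[B]_m.
Proof.
move=> M N g f surj_g.
have /choice[y yE] (i : 'I_m) : exists y, g y = f (delta_mx 0 i) by apply: surj_g.
pose h (v : 'rV[B]_m) := \sum_i v 0 i *: y i.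
have h_lin : linear h.
  move=> c u v; rewrite scaler_sumr -big_split; apply: eq_bigr => i _.
  by rewrite !mxE scalerDl scalerA.
pose h' : {linear _ -> _} := HB.pack h (GRing.isLinear.Build _ _ _ _ h h_lin).
exists h' => v; rewrite [v in RHS]row_sum_delta !linear_sum.
by apply: eq_bigr => i _; rewrite !linearZ /= yE.
Qed.

Fact row_entry_aug_linear m i : linear (fun v : 'rV[B]_m => FK_aug (v 0 i) : triv k).
Proof. by move=> c u v; rewrite !mxE raddfD /= FK_augM. Qed.

(** These maps form a k-basis of Hom(B^m, k), dual to the unit rows; for m = 1 the only one is the
    augmentation of the resolution. *)
Definition row_entry_aug m i : {linear 'rV[B]_m -> triv k} :=
  HB.pack (fun v : 'rV[B]_m => FK_aug (v 0 i) : triv k)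
    (GRing.isLinear.Build _ _ _ _ _ (@row_entry_aug_linear m i)).

Fact FK_diff_linear n : linear (fun v : 'rV[B]_(FK_N n.+1) => v *m FK_diff n).
Proof. by move=> c u v; rewrite mulmxDl scalemxAl. Qed.

Definition FK_diff_map n : {linear 'rV[B]_(FK_N n.+1) -> 'rV[B]_(FK_N n)} :=
  HB.pack (fun v : 'rV[B]_(FK_N n.+1) => v *m FK_diff n)
    (GRing.isLinear.Build _ _ _ _ _ (@FK_diff_linear n)).

Fact row_entry_aug_surj (y : triv k) : exists v, @row_entry_aug 1 0 v = y.
Proof.
exists (const_mx (y : k)%:A); rewrite /= mxE FK_augZ -FK_pi1 FK_augE aug3_1.
exact: mulr1.
Qed.

Definition FK_resolution : proj_resolution (triv k) :=
  ProjResolution (res_mod := fun n => 'rV[B]_(FK_N n)) (res_diff := FK_diff_map)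
    (res_aug := @row_entry_aug 1 0) (fun n => @free_row_projective (FK_N n))
    row_entry_aug_surj FK_diff_exact0 FK_diff_exact.

Lemma row_linear_triv m (f : {linear 'rV[B]_m -> triv k}) v :
  f v = \sum_i (f (delta_mx 0 i) : k)%:A *: row_entry_aug i v.
Proof.
rewrite [v in LHS]row_sum_delta linear_sum; apply: eq_bigr => i _.
by rewrite linearZ /= triv_scalar mulrC.
Qed.

End Resolution.

Theorem theorem4p14 (k : fieldType) (char0 : [pchar k] =i pred0) (n : nat) :
  Ext_dim (triv k) (triv k) n (FK_N n).
Proof.
apply: (@Ext_dim_minimal k (FK k) _ _ (FK_resolution k) n (FK_N n)
  (@row_entry_aug k (FK_N n))) => [m f v|f|l l0].
(* The three goals are minimality, spanning and independence; the last is seen by evaluation at the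
   unit rows. *)
- rewrite row_linear_triv big1 // => i _.
  rewrite triv_scalar /= mxE raddf_sum big1 ?mulr0 // => j _.
  by rewrite /= FK_augM FK_aug_diff mulr0.
- exists [ffun i => f (delta_mx 0 i)] => v; rewrite row_linear_triv.
  by apply: eq_bigr => i _; rewrite ffunE.
- apply/ffunP => j; have := l0 (delta_mx 0 j).
  rewrite (bigD1 j) //= triv_scalar big1 => [|i neij].
    by rewrite addr0 mxE !eqxx -FK_pi1 FK_augE aug3_1 mulr1 ffunE.
  by rewrite triv_scalar mxE eqxx /= (negbTE neij) raddf0 mulr0.
Qed.
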